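(* Let $d\ge 1$, $q_1,\dots,q_d$ be positive integers, $\Gamma=q_1\mathbb{Z}\oplus\cdots\oplus q_d\mathbb{Z}$, and let $V:\mathbb{Z}^d\to\mathbb{C}$ be a complex-valued $\Gamma$-periodic function. Then the following statements are equivalent: (1) There exist $l=(l_1,\dots,l_d)\in W$ and a constant $K\in\mathbb{C}$ such that for all $k\in\mathbb{C}^d$ and $\lambda\in\mathbb{C}$ $$\det(D_V(k)-\lambda I)=\prod_{n\in W}\left(K-\lambda+\sum_{j=1}^d\left(e^{2\pi i\frac{n_j+k_j}{q_j}}+e^{-2\pi i\frac{n_j+l_j+k_j}{q_j}}\right)\right).$$ (2) There exists an entire function $f:\mathbb{C}^d\to\mathbb{C}$ such that $(k,f(k))\in B(\Delta+V)$ for all $k\in\mathbb{C}^d$.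
   Context: A function $V:\mathbb{Z}^d\to\mathbb{C}$ is $\Gamma$-periodic if $V(n+\gamma)=V(n)$ for all $n\in\mathbb{Z}^d$, $\gamma\in\Gamma$. The discrete Laplacian is $(\Delta u)(n)=\sum_{\|n'-n\|_1=1}u(n')$, where $\|n'-n\|_1=\sum_{l=1}^d|n_l-n'_l|$. Let $W=\{n=(n_1,\dots,n_d)\in\mathbb{Z}^d: 0\le n_j\le q_j-1,\ j=1,\dots,d\}$ and $Q=q_1q_2\cdots q_d$. Let $\mathbf{e}_j$ be the standard basis of $\mathbb{Z}^d$. For $k=(k_1,\dots,k_d)\in\mathbb{C}^d$, $D_V(k)$ is the $Q\times Q$ matrix representing $\Delta+V$ acting on the $Q$-dimensional space of functions $u:\mathbb{Z}^d\to\mathbb{C}$ satisfying the Floquet-Bloch condition $u(n+q_j\mathbf{e}_j)=e^{2\pi i k_j}u(n)$ for all $n\in\mathbb{Z}^d$, $j=1,\dots,d$, where $u$ is identified with its values $\{u(n)\}_{n\in W}$. The Bloch variety is $B(\Delta+V)=\{(k,\lambda)\in\mathbb{C}^d\times\mathbb{C}:\det(D_V(k)-\lambda I)=0\}$. *)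

(* Defs.v *)
From HB Require Import structures.
From mathcomp Require Import all_boot all_order all_algebra.
From mathcomp Require Import complex.
From mathcomp Require Import all_classical all_reals all_analysis.

Set Implicit Arguments.
Unset Strict Implicit.
Unset Printing Implicit Defensive.

Import Order.TTheory GRing.Theory Num.Theory numFieldNormedType.Exports.

Local Open Scope classical_set_scope.
Local Open Scope ring_scope.
Local Open Scope complex_scope.

Section ComplexExponential.
Variable R : realType.

Definition cexp (z : R[i]) : R[i] :=
  (expR (complex.Re z) * cos (complex.Im z)) +i* (expR (complex.Re z) * sin (complex.Im z)).

(* e2pi z = exp (2 pi i z) *)
Definition e2pi (z : R[i]) : R[i] := cexp ((0 +i* (2 * pi)) * z).

Lemma cexp0 : cexp 0 = 1.
Proof. by rewrite /cexp /= expR0 cos0 sin0 mulr1 mulr0. Qed.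

Lemma cexpD (z w : R[i]) : cexp (z + w) = cexp z * cexp w.
Proof.
case: z w => [a b] [c d]; rewrite /cexp /= expRD cosD sinD.
rewrite mulrBr mulrDr; congr (_ +i* _).
  by congr (_ - _); rewrite mulrACA.
by rewrite addrC; congr (_ + _); rewrite mulrACA.
Qed.

Lemma e2pi0 : e2pi 0 = 1.
Proof. by rewrite /e2pi mulr0 cexp0. Qed.

Lemma e2piD (z w : R[i]) : e2pi (z + w) = e2pi z * e2pi w.
Proof. by rewrite /e2pi mulrDr cexpD. Qed.

End ComplexExponential.

Section DiscreteSchrodinger.
Variables (R : realType) (d : nat).
Implicit Types (u V : 'rV[int]_d -> R[i]) (n : 'rV[int]_d).

Definition norm1 n : int := \sum_(j < d) `|n 0 j|.

Definition laplacian u n : R[i] :=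
  \sum_(n' \in [set n' : 'rV[int]_d | norm1 (n' - n) = 1]) u n'.

Definition schrodinger V u n : R[i] := laplacian u n + V n * u n.

Lemma finite_neighbours n :
  finite_set [set n' : 'rV[int]_d | norm1 (n' - n) = 1].
Proof.
pose g (c : {ffun 'I_d -> 'I_3}) : 'rV[int]_d :=
  n + \row_j ((c j : nat)%:Z - 1).
have fG : finite_set (g @` setT) by exact/finite_image/finite_finset.
apply: sub_finite_set fG => n' /= h.
have le1 (j : 'I_d) : `|(n' - n) 0 j| <= 1.
  rewrite -h /norm1 (bigD1 j) //= lerDl.
  by apply: sumr_ge0 => i _; exact: normr_ge0.
have ge0 (j : 'I_d) : 0 <= (n' - n) 0 j + 1.
  by have := le1 j; rewrite ler_norml => /andP[h1 _]; rewrite -lerBlDr sub0r.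
have lt3 (j : 'I_d) : (absz ((n' - n) 0%R j + 1)%R < 3)%N.
  rewrite -ltz_nat gez0_abs ?ge0 //.
  have := le1 j; rewrite ler_norml => /andP[_ h2].
  by rewrite (le_lt_trans (lerD h2 (lexx 1))).
exists [ffun j => Ordinal (lt3 j)] => //.
apply/rowP => j; rewrite !mxE ffunE /= gez0_abs; last by have := ge0 j; rewrite !mxE.
by rewrite addrK !mxE addrCA subrr addr0.
Qed.

Lemma laplacian_sum (I : finType) (c : I -> R[i])
    (b : I -> 'rV[int]_d -> R[i]) n :
  laplacian (fun n' => \sum_i c i * b i n') n = \sum_i c i * laplacian (b i) n.
Proof.
rewrite /laplacian fsbig_finite; last exact: finite_neighbours.
rewrite exchange_big /=; apply: eq_bigr => i _.
by rewrite fsbig_finite ?mulr_sumr //; exact: finite_neighbours.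
Qed.

Variable q : 'I_d -> nat.

(* The lattice Gamma = q_1 Z + ... + q_d Z. *)
Definition lattice : set 'rV[int]_d :=
  [set g : 'rV[int]_d | forall j, ((q j)%:Z %| g 0%R j)%Z].

Definition lattice_periodic V := forall n g, lattice g -> V (n + g) = V n.

(* The index type of the box W, embedded in Z^d by [site]. *)
Definition cell : finType := {dffun forall j : 'I_d, 'I_(q j)}.

Definition site (n : cell) : 'rV[int]_d := \row_j (n j : nat)%:Z.

Lemma card_cell : #|cell| = (\prod_(j < d) q j)%N.
Proof.
rewrite card_dep_ffun foldrE big_map big_enum /=.
by apply: eq_bigr => j _; rewrite card_ord.
Qed.

Definition floquet_space (k : 'rV[R[i]]_d) : set ('rV[int]_d -> R[i]) :=
  [set u | forall n (j : 'I_d),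
     u (n + delta_mx 0 j *+ q j) = e2pi (k 0 j) * u n].

(* The element of the Floquet space that is 1 at m and 0 at the other points
   of W; (%/)%Z is the floor of the quotient. *)
Definition floquet_basis (k : 'rV[R[i]]_d) (m : cell) n : R[i] :=
  if [forall j, ((n 0%R j %% (q j)%:Z)%Z == (m j : nat)%:Z)]
  then e2pi (\sum_(j < d) ((n 0%R j %/ (q j)%:Z)%Z)%:~R * k 0 j)
  else 0.

(* Column b holds the values on W of the image of the b-th basis function. *)
Definition floquet_matrix V (k : 'rV[R[i]]_d) : 'M[R[i]]_#|cell| :=
  \matrix_(a, b)
    schrodinger V (floquet_basis k (enum_val b)) (site (enum_val a)).

Definition bloch_variety V : set ('rV[R[i]]_d * R[i]) :=
  [set p | \det (floquet_matrix V p.1 - p.2%:M) = 0].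

Section FloquetMatrixSpec.
Hypothesis q_gt0 : forall j, (0 < q j)%N.

Let qz_neq0 j : (q j)%:Z != 0.
Proof. by rewrite eqz_nat -lt0n. Qed.

Lemma floquet_basis_site k (m n : cell) :
  floquet_basis k m (site n) = (m == n)%:R.
Proof.
have modE j : ((site n 0%R j) %% (q j)%:Z)%Z = (n j : nat)%:Z.
  by rewrite mxE modz_small //= ltz_nat ltn_ord.
rewrite /floquet_basis; case: eqP => [->|mn]; case: ifPn => // /forallP h.
- rewrite big1 ?e2pi0 // => j _.
  by rewrite mxE divz_small ?mul0r //= ltz_nat ltn_ord.
- by case: h => j; rewrite modE.
- case: mn; apply/ffunP => j; apply/val_inj.
  by have := h j; rewrite modE eqz_nat => /eqP.
Qed.

Lemma floquet_basis_floquet k (m : cell) :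
  floquet_space k (floquet_basis k m).
Proof.
move=> n j; rewrite /floquet_basis.
have shiftE i : (n + delta_mx 0 j *+ q j) 0 i
    = n 0 i + (i == j)%:Z * (q i)%:Z.
  rewrite mxE mulmxnE mxE eqxx /=; congr (_ + _).
  by case: eqP => [->|_] /=; rewrite ?mulr1n ?mulr0n ?mul0rn ?mul0r ?mul1r ?natz.
have -> : [forall i, (((n + delta_mx 0 j *+ q j)%R 0%R i %% (q i)%:Z)%Z
            == (m i : nat)%:Z)]
        = [forall i, ((n 0%R i %% (q i)%:Z)%Z == (m i : nat)%:Z)].
  by apply: eq_forallb => i; rewrite shiftE addrC modzMDl.
case: ifP => _; last by rewrite mulr0.
rewrite -e2piD; congr e2pi; rewrite [LHS](bigD1 j) //= [in RHS](bigD1 j) //=.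
rewrite shiftE eqxx mul1r divzDr ?dvdzz // divzz qz_neq0 /=.
rewrite intrD mulrDl mul1r -addrA addrCA; congr (_ + (_ + _)).
by apply: eq_bigr => i /negPf ij; rewrite shiftE ij mul0r addr0.
Qed.

Lemma floquet_shift k u n (g : 'rV[int]_d) : floquet_space k u ->
  u (n + \row_j (g 0 j * (q j)%:Z)) = e2pi (\sum_j (g 0 j)%:~R * k 0 j) * u n.
Proof.
move=> uF.
have stepn (j : 'I_d) (c : nat) n0 :
    u (n0 + delta_mx 0 j *+ (c * q j)) = e2pi (c%:R * k 0 j) * u n0.
  elim: c n0 => [|c IH] n0; first by rewrite mul0n mulr0n addr0 mul0r e2pi0 mul1r.
  by rewrite mulSn mulrnDr addrA IH uF mulrA -e2piD -[in RHS]natr1 mulrDl mul1r.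
have stepz (j : 'I_d) (c : int) n0 :
    u (n0 + delta_mx 0 j *~ (c * (q j)%:Z)) = e2pi (c%:~R * k 0 j) * u n0.
  case: c => c; first by rewrite -PoszM; exact: stepn.
  rewrite NegzE mulNr -PoszM mulrNz.
  rewrite -[in RHS](subrK (delta_mx 0 j *~ (c.+1 * q j)%N) n0) stepn mulrA.
  by rewrite -e2piD -mulrDl -pmulrn addNr mul0r e2pi0 mul1r mulrNz.
have -> : \row_j (g 0 j * (q j)%:Z)
    = \sum_j (delta_mx 0 j : 'rV[int]_d) *~ (g 0 j * (q j)%:Z).
  apply/rowP => i; rewrite mxE summxE (bigD1 i) //= big1 ?addr0 => [|j ji].
    by rewrite -scaler_int !mxE !eqxx mulr1 intz.
  by rewrite -scaler_int !mxE eq_sym (negPf ji) andbF mulr0.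
elim: (index_enum _) n => [|j r IH] n0.
  by rewrite !big_nil addr0 e2pi0 mul1r.
by rewrite !big_cons addrA IH stepz mulrA -e2piD addrC.
Qed.

Lemma floquet_expand k u : floquet_space k u ->
  forall n, u n = \sum_(m : cell) u (site m) * floquet_basis k m n.
Proof.
move=> uF n.
have lt j : (absz (n 0%R j %% (q j)%:Z)%Z < q j)%N.
  by rewrite -ltz_nat gez0_abs ?modz_ge0 // ltz_mod.
pose m0 : cell := [ffun j => Ordinal (lt j)].
have m0E j : (n 0%R j %% (q j)%:Z)%Z = (m0 j : nat)%:Z.
  by rewrite ffunE /= gez0_abs ?modz_ge0.
rewrite (bigD1 m0) //= big1 ?addr0 => [|m mm0]; last first.
  rewrite /floquet_basis; case: ifPn => [/forallP h|_]; last by rewrite mulr0.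
  case/eqP: mm0; apply/ffunP => j; apply/val_inj/eqP.
  by rewrite -eqz_nat -m0E eq_sym; exact: h.
rewrite /floquet_basis ifT; last by apply/forallP => j; rewrite m0E.
have {1}-> : n = site m0 + \row_j ((\row_i (n 0%R i %/ (q i)%:Z)%Z) 0 j * (q j)%:Z).
  by apply/rowP => j; rewrite !mxE -m0E addrC -divz_eq.
rewrite (floquet_shift _ _ uF) mulrC; congr (_ * e2pi _).
by apply: eq_bigr => j _; rewrite mxE.
Qed.

Lemma schrodinger_floquet V k u : lattice_periodic V -> floquet_space k u ->
  floquet_space k (schrodinger V u).
Proof.
move=> VP uF n j; rewrite /schrodinger mulrDr; congr (_ + _); last first.
  rewrite uF VP => [|i]; first exact: mulrCA.
  rewrite mulmxnE mxE eqxx /=.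
  by case: eqP => [->|_] /=; rewrite ?mulr0n ?mul0rn ?dvdz0 // mulr1n natz dvdzz.
set s := delta_mx 0 j *+ q j.
rewrite /laplacian (reindex_fsbig (fun x => x + s)
  [set n' : 'rV[int]_d | norm1 (n' - n) = 1]) /=; last first.
  split=> [x /=|x y _ _ /addIr //|x /= hx].
  - by rewrite opprD addrACA subrr addr0.
  - exists (x - s); last by rewrite subrK.
    by rewrite /= -addrA -opprD [s + n]addrC.
rewrite !fsbig_finite; try exact: finite_neighbours.
by rewrite mulr_sumr; apply: eq_bigr => x _; rewrite uF.
Qed.

Lemma floquet_matrixP V k u : floquet_space k u ->
  forall a : 'I_#|cell|, schrodinger V u (site (enum_val a)) =
    \sum_b floquet_matrix V k a b * u (site (enum_val b)).
Proof.
move=> uF a.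
have uE : u = fun n => \sum_(m : cell) u (site m) * floquet_basis k m n.
  by apply/funext => n; exact: floquet_expand.
rewrite {1}uE /schrodinger laplacian_sum mulr_sumr -big_split /=.
rewrite (reindex (@enum_val cell predT)) /=; last exact/onW_bij/enum_val_bij.
by apply: eq_bigr => b _; rewrite mxE /schrodinger [RHS]mulrC mulrDr [V _ * (_ * _)]mulrCA.
Qed.

End FloquetMatrixSpec.

End DiscreteSchrodinger.

(* Complex Frechet differentiability at every point: the scalars of both
   normed modules are R[i]. *)
Definition entire (R : realType) (d : nat) (f : 'rV[R[i]]_d -> R[i]) :=
  forall k, differentiable (f : 'rV[R[i]]_d -> R[i]^o) k.

(* Main.v *)
Require Import Defs.
From HB Require Import structures.
From mathcomp Require Import all_boot all_order all_algebra.
From mathcomp Require Import complex.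
From mathcomp Require Import all_classical all_reals all_analysis.
From mathcomp Require Import ring lra zify.

Import Order.TTheory GRing.Theory Num.Theory numFieldNormedType.Exports.

Set Implicit Arguments.
Unset Strict Implicit.
Unset Printing Implicit Defensive.

Local Open Scope classical_set_scope.
Local Open Scope ring_scope.
Local Open Scope complex_scope.


(** One direction is immediate: the factor of the product with index n = 0
    vanishes when lambda is K plus the corresponding sum of exponentials, and
    this sum is an entire function of k.

    Conversely let f be an entire branch of the Bloch variety, and write x_j
    for e2pi (k_j / q_j). Three facts about f come from eigenvectors. Shifting
    k by an integer vector does not change the Floquet matrix, so every
    translate of f by such a vector is again a branch. A Floquet eigenvector
    becomes a lattice-periodic function in a suitable gauge, and evaluating
    the eigenvalue equation where it has maximal modulus bounds f by a constant
    plus the sum of the moduli of all x_j and 1 / x_j ([bloch_bound]). When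
    one of these amplitudes, say x_j, dominates all the other terms, the
    operator is nearly x_j times a cyclic shift of order q_j, so f / x_j is
    nearly a root of unity of order q_j ([bloch_root_of_unity]).

    If f (k + m) = f k identically for an integer vector m, follow the
    translation from k to k + m continuously far out in the region where x_j
    dominates. There f / x_j stays near the finite set of roots of unity, hence
    near a single one, while the translation multiplies it by
    e2pi (- m_j / q_j); so q_j divides m_j ([branch_period_dvd]). Therefore the
    Q translates of f by the points of W are pairwise distinct functions.
    Entire functions form an integral domain, so these translates are all the
    roots of the characteristic polynomial ([bloch_det_factor]). The translate
    of f by q_j in the j-th variable is one of them, and by the same
    divisibility it is f itself ([branch_periodic]).

    So f has period q_j in k_j and grows no faster than x_j and 1 / x_j, which
    forces f to be a combination of 1, x_j and 1 / x_j as a function of k_j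
    ([periodic_trig_poly]). The coefficients of x_j and 1 / x_j are bounded
    entire functions of the other variables, hence constants by Liouville. This
    holds for every j, so f is a constant K plus a linear combination of the
    x_j and 1 / x_j ([branch_structure]), and the asymptotics show that the
    coefficients are roots of unity ([coef_root_of_unity]). Inserting this into
    the factorisation and reindexing W gives the product formula.

    The one-variable complex analysis rests on a discrete form of Goursat's
    theorem. Riemann sums with 2 ^ n points per side around a square are
    exactly additive under cutting the square into four and vanish exactly on
    affine functions, which is all that the bisection argument uses
    ([goursat]). Applied to (g z - g b) ^ 2 / (z - b), which is entire for
    elementary reasons, it gives the estimate |g b| <= 5 max |g| over the
    boundary of a square centred at b ([cauchy_bound]). Liouville's theorem and
    the identity theorem follow from this estimate alone. *)

(** * Complex modulus with values in the reals *)

(** The norm of R[i] is itself complex-valued; real values give access to the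
    total order. *)
Notation cabs := (@Normc.normc _).

Section Modulus.
Variable R : realType.
Implicit Types z w : R[i].

Lemma normc_cabs z : `|z| = (cabs z)%:C. Proof. by []. Qed.

Lemma cabs_ge0 z : 0 <= cabs z.
Proof. by rewrite -lecR -normc_cabs normr_ge0. Qed.

Lemma cabs0 : cabs (0 : R[i]) = 0.
Proof. exact: Normc.normc0. Qed.

Lemma cabs1 : cabs (1 : R[i]) = 1.
Proof. exact: Normc.normc1. Qed.

Lemma cabs_eq0 z : (cabs z == 0) = (z == 0).
Proof.
by apply/eqP/eqP => [/Normc.eq0_normc //|->]; rewrite cabs0.
Qed.

Lemma cabs_gt0 z : (0 < cabs z) = (z != 0).
Proof. by rewrite lt_def cabs_eq0 cabs_ge0 andbT. Qed.

Lemma cabsM z w : cabs (z * w) = cabs z * cabs w.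
Proof. exact: Normc.normcM. Qed.

Lemma cabsV z : cabs z^-1 = (cabs z)^-1.
Proof. exact: Normc.normcV. Qed.

Lemma cabsN z : cabs (- z) = cabs z.
Proof. exact: normcN. Qed.

Lemma cabsC z w : cabs (z - w) = cabs (w - z).
Proof. by rewrite -cabsN opprB. Qed.

Lemma cabsX z n : cabs (z ^+ n) = cabs z ^+ n.
Proof. by elim: n => [|n IH]; rewrite ?cabs1 // !exprS cabsM IH. Qed.

Lemma cabsD z w : cabs (z + w) <= cabs z + cabs w.
Proof. exact: le_normcD. Qed.

Lemma cabsB z w : cabs (z - w) <= cabs z + cabs w.
Proof. by rewrite -(cabsN w); exact: cabsD. Qed.

Lemma cabs_le_add z w : cabs z <= cabs w + cabs (z - w).
Proof. by rewrite -{1}(subrK w z) addrC cabsD. Qed.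

Lemma cabs_sum (I : Type) (r : seq I) (P : pred I) (F : I -> R[i]) :
  cabs (\sum_(i <- r | P i) F i) <= \sum_(i <- r | P i) cabs (F i).
Proof.
elim/big_rec2: _ => [|i x y _ h]; first by rewrite cabs0.
by apply: le_trans (cabsD _ _) _; rewrite lerD2l.
Qed.

Lemma Re_le_cabs z : `|complex.Re z| <= cabs z.
Proof.
case: z => a b /=.
by rewrite -sqrtr_sqr ler_wsqrtr // lerDl sqr_ge0.
Qed.

Lemma Im_le_cabs z : `|complex.Im z| <= cabs z.
Proof.
case: z => a b /=.
by rewrite -sqrtr_sqr ler_wsqrtr // lerDr sqr_ge0.
Qed.

Lemma cabs_real (x : R) : cabs x%:C = `|x|.
Proof. by rewrite /= expr0n addr0 sqrtr_sqr. Qed.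

Lemma cabs_i : cabs ('i : R[i]) = 1.
Proof. by rewrite /= expr0n expr1n add0r sqrtr1. Qed.

Lemma cabs_im (x : R) : cabs (0 +i* x) = `|x|.
Proof. by rewrite /= expr0n add0r sqrtr_sqr. Qed.

Lemma cabs_le_ReIm z : cabs z <= `|complex.Re z| + `|complex.Im z|.
Proof.
case: z => a b; rewrite -[_ +i* _]/(_); have -> : a +i* b = a%:C + 0 +i* b.
  by rewrite /=; simpc.
by apply: le_trans (cabsD _ _) _; rewrite cabs_real cabs_im /= addr0 add0r.
Qed.

Lemma cabs_nat n : cabs (n%:R : R[i]) = n%:R.
Proof.
have -> : (n%:R : R[i]) = (n%:R : R)%:C by rewrite rmorph_nat.
by rewrite cabs_real ger0_norm.
Qed.

End Modulus.

(** * Complex differentiability in one variable *)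

Section Differentiability.
Variable R : realType.
Local Notation C := R[i].

(** The complex derivative in real epsilons and moduli, the form in which
    estimates are made; [cderiv_atP] relates it to [differentiable]. *)
Definition cderiv_at (g : C -> C) (a c : C) := forall e : R, 0 < e ->
  exists2 r : R, 0 < r &
    forall z, cabs (z - a) < r -> cabs (g z - g a - c * (z - a)) <= e * cabs (z - a).

Lemma cderiv_atP (g : C -> C) a :
  differentiable (g : C^o -> C^o) a <-> exists c, cderiv_at g a c.
Proof.
rewrite -derivable1_diffP; split=> [/cvg_ex[/= c /cvgrPdist_le hc]|[c hc]].
  exists c => e e0.
  have /hc : (0 : C) < e%:C by rewrite ltcR.
  rewrite near_withinE => /nbhs_ballP[/= r r0 hr].
  have := r0; rewrite ltcE /= => /andP[/eqP rI r0'].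
  exists (complex.Re r) => // z hz.
  have [->|za] := eqVneq z a; first by rewrite !subrr mulr0 subr0 cabs0 mulr0.
  have zna : z - a != 0 by rewrite subr_eq0.
  have := hr (z - a); rewrite /ball /= sub0r normrN normc_cabs.
  have -> : r = (complex.Re r)%:C by case: (r) rI => x y /= ->.
  rewrite ltcR => /(_ hz zna).
  rewrite [(z - a)%:A]mulr1 subrK normc_cabs lecR => h.
  have -> : g z - g a - c * (z - a) = - (z - a) * (c - (z - a)^-1 *: (g z - g a)).
    by rewrite /GRing.scale /=; field.
  by rewrite cabsM cabsN mulrC ler_wpM2r ?cabs_ge0.
apply/cvg_ex; exists c; apply/cvgrPdist_le => /= e; rewrite ltcE /= => /andP[/eqP eI e0].
have -> : e = (complex.Re e)%:C by case: (e) eI => x y /= ->.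
have [r r0 hr] := hc _ e0.
rewrite near_withinE; apply/nbhs_ballP. exists r%:C; first by rewrite /= ltcR.
move=> h; rewrite /ball /= sub0r normrN normc_cabs ltcR => hh h0.
have := hr (h + a); rewrite addrK => /(_ hh) h1.
rewrite [h%:A]mulr1 normc_cabs lecR.
have -> : c - h^-1 *: (g (h + a) - g a) = - h^-1 * (g (h + a) - g a - c * h).
  by rewrite /GRing.scale /=; field.
by rewrite cabsM cabsN cabsV ler_pdivrMl ?cabs_gt0 // [cabs h * _]mulrC.
Qed.

Definition entire1 (g : C -> C) := forall a, differentiable (g : C^o -> C^o) a.

Lemma entire1_cst (c : C) : entire1 (fun=> c).
Proof. by move=> a; exact: differentiable_cst. Qed.

Lemma entire1_id : entire1 (fun z => z).
Proof. by move=> a; exact: ex_diff. Qed.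

Lemma entire1D g h : entire1 g -> entire1 h -> entire1 (fun z => g z + h z).
Proof. by move=> hg hh a; exact: differentiableD. Qed.

Lemma entire1N g : entire1 g -> entire1 (fun z => - g z).
Proof. by move=> hg a; exact: differentiableN. Qed.

Lemma entire1B g h : entire1 g -> entire1 h -> entire1 (fun z => g z - h z).
Proof. by move=> hg hh; apply: entire1D => //; exact: entire1N. Qed.

Lemma differentiable_mul1 (g h : C -> C) a : differentiable (g : C^o -> C^o) a ->
  differentiable (h : C^o -> C^o) a ->
  differentiable ((fun z => g z * h z) : C^o -> C^o) a.
Proof. by move=> hg hh; exact: differentiableM. Qed.

Lemma entire1M g h : entire1 g -> entire1 h -> entire1 (fun z => g z * h z).
Proof. by move=> hg hh a; exact: differentiable_mul1. Qed.

Lemma differentiable_exp1 (g : C -> C) n a : differentiable (g : C^o -> C^o) a ->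
  differentiable ((fun z => g z ^+ n) : C^o -> C^o) a.
Proof.
move=> hg; elim: n => [|n IH].
  by under eq_fun do rewrite expr0; exact: differentiable_cst.
by under eq_fun do rewrite exprS; exact: differentiable_mul1.
Qed.

Lemma entire1X g n : entire1 g -> entire1 (fun z => g z ^+ n).
Proof. by move=> hg a; exact: differentiable_exp1. Qed.

Lemma entire1_comp g h : entire1 g -> entire1 h -> entire1 (fun z => g (h z)).
Proof.
move=> hg hh a.
exact: (@differentiable_comp _ C^o C^o C^o h g).
Qed.

Lemma differentiable_inv1 (g : C -> C) a : differentiable (g : C^o -> C^o) a ->
  g a != 0 -> differentiable ((fun z => (g z)^-1) : C^o -> C^o) a.
Proof. by move=> hg ga; exact: (@differentiableV _ C^o). Qed.

End Differentiability.



(** * Goursat's theorem for Riemann sums *)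

Section Goursat.
Variable R : realType.
Local Notation C := R[i].
Implicit Types (u g : C -> C) (a v p : C).

(** The left Riemann sum, with 2 ^ n points, of the integral of u along the
    edge from p to p + v. *)
Definition edge_sum n u p v : C :=
  \sum_(j < 2 ^ n) u (p + (j%:R / 2 ^+ n) * v) * (v / 2 ^+ n).

(** The corresponding sum around the square with corners a, a + v,
    a + v + 'i v and a + 'i v. Opposite edges are both sampled in the direction
    of v or 'i v, so that sums over an edge shared by two squares cancel. *)
Definition square_sum n u a v : C :=
  edge_sum n u a v + edge_sum n u (a + v) ('i * v)
  - edge_sum n u (a + 'i * v) v - edge_sum n u a ('i * v).

Lemma edge_sum_halve n u p v :
  edge_sum n.+1 u p v = edge_sum n u p (v / 2) + edge_sum n u (p + v / 2) (v / 2).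
Proof.
have n2 : (2 ^+ n : C) != 0 by rewrite expf_neq0 // pnatr_eq0.
rewrite /edge_sum expnS mul2n -addnn big_split_ord /=.
congr (_ + _); apply: eq_bigr => j _.
  by congr (u _ * _); rewrite exprS; field.
by congr (u _ * _); rewrite ?natrD ?natrX exprS; field.
Qed.

(** Subdivision is exact at every finite level, which makes it possible to
    run the bisection argument on the sums without taking their limit. *)
Lemma square_sum_halve n u a v : square_sum n.+1 u a v =
  square_sum n u a (v / 2) + square_sum n u (a + v / 2) (v / 2) +
  square_sum n u (a + 'i * (v / 2)) (v / 2) +
  square_sum n u (a + v / 2 + 'i * (v / 2)) (v / 2).
Proof.
rewrite /square_sum !edge_sum_halve -!(mulrA _ v).
set w := v / 2.
have -> : v = w + w by rewrite /w; field.
rewrite !mulrDr !addrA.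
have -> : a + 'i * w + w = a + w + 'i * w by rewrite addrAC.
have -> : a + 'i * w + 'i * w + w = a + w + 'i * w + 'i * w by ring.
have -> : a + w + 'i * w + w = a + w + w + 'i * w by ring.
ring.
Qed.

Lemma edge_sumD n u1 u2 p v :
  edge_sum n (fun z => u1 z + u2 z) p v = edge_sum n u1 p v + edge_sum n u2 p v.
Proof. by rewrite /edge_sum -big_split; apply: eq_bigr => j _; rewrite mulrDl. Qed.

Lemma edge_sumZ n c u p v :
  edge_sum n (fun z => c * u z) p v = c * edge_sum n u p v.
Proof. by rewrite /edge_sum mulr_sumr; apply: eq_bigr => j _; rewrite -mulrA. Qed.

Lemma square_sumD n u1 u2 a v :
  square_sum n (fun z => u1 z + u2 z) a v = square_sum n u1 a v + square_sum n u2 a v.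
Proof. by rewrite /square_sum !edge_sumD; ring. Qed.

Lemma square_sumZ n c u a v :
  square_sum n (fun z => c * u z) a v = c * square_sum n u a v.
Proof. by rewrite /square_sum !edge_sumZ; ring. Qed.

Lemma eq_square_sum n u1 u2 a v : u1 =1 u2 ->
  square_sum n u1 a v = square_sum n u2 a v.
Proof. by move=> /funext ->. Qed.

(** The values on opposite edges differ by a constant, and the two constants
    cancel because ('i v) v = v ('i v). *)
Lemma square_sum_affine n c0 c1 a v :
  square_sum n (fun z => c0 + c1 * z) a v = 0.
Proof.
have n2 : (2 ^+ n : C) != 0 by rewrite expf_neq0 // pnatr_eq0.
have edgeB p q w : edge_sum n (fun z => c0 + c1 * z) p w
    - edge_sum n (fun z => c0 + c1 * z) q w = c1 * (p - q) * w.
  rewrite /edge_sum -sumrB (eq_bigr (fun=> c1 * (p - q) * (w / 2 ^+ n))).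
    by rewrite sumr_const card_ord -[LHS]mulr_natr natrX; field.
  by move=> j _; ring.
rewrite /square_sum.
have := edgeB a (a + 'i * v) v; have := edgeB (a + v) a ('i * v).
set e1 := edge_sum _ _ a v; set e2 := edge_sum _ _ (a + v) _.
set e3 := edge_sum _ _ _ v; set e4 := edge_sum _ _ _ _ => h1 h2.
have -> : e1 + e2 - e3 - e4 = (e1 - e3) + (e2 - e4) by ring.
by rewrite h1 h2; ring.
Qed.

Definition on_square_edge a v z := exists2 t : R, 0 <= t <= 1 &
  [\/ z = a + t%:C * v, z = a + 'i * v + t%:C * v,
      z = a + t%:C * ('i * v) | z = a + v + t%:C * ('i * v)].

Lemma cabs_edge_sum n u p v M :
  (forall t : R, 0 <= t <= 1 -> cabs (u (p + t%:C * v)) <= M) ->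
  cabs (edge_sum n u p v) <= cabs v * M.
Proof.
move=> h; apply: le_trans (cabs_sum _ _ _) _.
have n2 : (0 : R) < 2 ^+ n by rewrite exprn_gt0.
have e2 : (2 ^+ n : C) = (2 ^+ n : R)%:C by rewrite rmorphXn /= rmorph_nat.
apply: (@le_trans _ _ (\sum_(j < 2 ^ n) (cabs v / 2 ^+ n * M))).
  apply: ler_sum => j _; rewrite cabsM cabsM cabsV e2 cabs_real gtr0_norm //.
  rewrite mulrC ler_wpM2l ?mulr_ge0 ?cabs_ge0 ?invr_ge0 ?(ltW n2) //.
  have -> : (j%:R / (2 ^+ n : R)%:C : C) = (j%:R / 2 ^+ n : R)%:C.
    by rewrite rmorphM /= fmorphV rmorph_nat.
  apply: h; rewrite divr_ge0 ?(ltW n2) ?ler0n // ler_pdivrMr // mul1r -natrX ler_nat.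
  exact: ltnW (ltn_ord j).
rewrite sumr_const card_ord -[_ *+ _]mulr_natr natrX.
rewrite le_eqVlt; apply/orP; left; apply/eqP; field.
by rewrite gt_eqF.
Qed.

Lemma cabs_square_sum n u a v M :
  (forall z, on_square_edge a v z -> cabs (u z) <= M) ->
  cabs (square_sum n u a v) <= 4 * (cabs v * M).
Proof.
move=> h; have iv : cabs ('i * v) = cabs v by rewrite cabsM cabs_i mul1r.
have h1 : cabs (edge_sum n u a v) <= cabs v * M.
  by apply: cabs_edge_sum => t t01; apply: h; exists t => //; constructor 1.
have h2 : cabs (edge_sum n u (a + 'i * v) v) <= cabs v * M.
  by apply: cabs_edge_sum => t t01; apply: h; exists t => //; constructor 2.
have h3 : cabs (edge_sum n u a ('i * v)) <= cabs v * M.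
  by rewrite -iv; apply: cabs_edge_sum => t t01; apply: h; exists t => //; constructor 3.
have h4 : cabs (edge_sum n u (a + v) ('i * v)) <= cabs v * M.
  by rewrite -iv; apply: cabs_edge_sum => t t01; apply: h; exists t => //; constructor 4.
rewrite /square_sum.
have := cabsB (edge_sum n u a v + edge_sum n u (a + v) ('i * v)
  - edge_sum n u (a + 'i * v) v) (edge_sum n u a ('i * v)).
have := cabsB (edge_sum n u a v + edge_sum n u (a + v) ('i * v))
  (edge_sum n u (a + 'i * v) v).
have := cabsD (edge_sum n u a v) (edge_sum n u (a + v) ('i * v)).
lra.
Qed.

(** A one-dimensional form of the nested squares principle, used for the real
    and for the imaginary parts of the corners. *)
Lemma nested_point (lo : nat -> R) (s : R) : 0 < s ->
  (forall m, lo m <= lo m.+1 /\ lo m.+1 + s / 2 ^+ m.+1 <= lo m + s / 2 ^+ m) ->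
  exists x, forall m, lo m <= x <= lo m + s / 2 ^+ m.
Proof.
move=> s0 h.
have lo_le k m : lo m <= lo (m + k)%N.
  elim: k => [|k IH]; first by rewrite addn0.
  by rewrite addnS; apply: le_trans IH _; have [] := h (m + k)%N.
have hi_le k m : lo (m + k)%N + s / 2 ^+ (m + k) <= lo m + s / 2 ^+ m.
  elim: k => [|k IH]; first by rewrite addn0.
  by rewrite addnS; apply: le_trans IH; have [] := h (m + k)%N.
have pos m : 0 < s / 2 ^+ m by rewrite divr_gt0 // exprn_gt0.
have bnd m n : lo n <= lo m + s / 2 ^+ m.
  have [mn|nm] := leqP m n.
    have := hi_le (n - m)%N m; rewrite (subnKC mn); apply: le_trans.
    by rewrite lerDl ltW.
  have := lo_le (m - n)%N n; rewrite (subnKC (ltnW nm)) => /le_trans; apply.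
  by rewrite lerDl ltW.
exists (sup (range lo)) => m; apply/andP; split.
  apply: sup_upper_bound; last by exists m.
  by split; [exists (lo 0%N); exists 0%N|exists (lo 0%N + s / 2 ^+ 0) => _ [n _ <-]].
by apply: ge_sup => [|_ [n _ <-]]; [exists (lo 0%N); exists 0%N|].
Qed.

(** Arbitrarily large n are asked for rather than all n, because one of the
    four subsquares must inherit this at infinitely many levels, but not
    necessarily at all of them. *)
Definition bad_square u (a : C) (s e : R) :=
  forall N, exists2 n, (N <= n)%N & e < cabs (square_sum n u a s%:C).

Lemma bad_square_halve u a s e : bad_square u a s e ->
  exists b : bool * bool, bad_square u
    (a + (if b.1 then (s / 2)%:C else 0) + (if b.2 then 'i * (s / 2)%:C else 0))
    (s / 2) (e / 4).
Proof.
move=> bad; apply: contrapT => nbad.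
have good b : exists N, forall n, (N <= n)%N -> cabs (square_sum n u
    (a + (if b.1 then (s / 2)%:C else 0) + (if b.2 then 'i * (s / 2)%:C else 0))
    (s / 2)%:C) <= e / 4.
  apply: contrapT => hN; apply: nbad; exists b => N.
  apply: contrapT => hn; apply: hN; exists N => n Nn.
  by rewrite leNgt; apply/negP => lt; apply: hn; exists n.
have [n1 h1] := good (false, false); have [n2 h2] := good (true, false).
have [n3 h3] := good (false, true); have [n4 h4] := good (true, true).
have [[//|n] ] := bad (n1 + n2 + n3 + n4).+1; rewrite ltnS => hn.
have {}h1 := h1 n (leq_trans (leq_trans (leq_addr _ _)
  (leq_trans (leq_addr _ _) (leq_addr _ _))) hn).
have {}h2 := h2 n (leq_trans (leq_trans (leq_addl _ _)
  (leq_trans (leq_addr _ _) (leq_addr _ _))) hn).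
have {}h3 := h3 n (leq_trans (leq_trans (leq_addl _ _) (leq_addr _ _)) hn).
have {}h4 := h4 n (leq_trans (leq_addl _ _) hn).
rewrite square_sum_halve.
have -> : (s%:C / 2 : C) = (s / 2)%:C by rewrite rmorphM /= fmorphV rmorph_nat.
move: h1 h2 h3 h4; rewrite /= !addr0.
set p1 := square_sum _ _ _ _; set p2 := square_sum _ _ _ _.
set p3 := square_sum _ _ _ _; set p4 := square_sum _ _ _ _ => h1 h2 h3 h4.
have := cabsD (p1 + p2 + p3) p4; have := cabsD (p1 + p2) p3; have := cabsD p1 p2.
lra.
Qed.

Lemma on_square_edge_near a s x y z : 0 <= s -> 
  complex.Re a <= x <= complex.Re a + s ->
  complex.Im a <= y <= complex.Im a + s ->
  on_square_edge a s%:C z -> cabs (z - x +i* y) <= 2 * s.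
Proof.
move=> s0 /andP[x1 x2] /andP[y1 y2] [t /andP[t0 t1]].
case: a x1 x2 y1 y2 => ar ai /= x1 x2 y1 y2 hz.
have ts0 : 0 <= t * s by rewrite mulr_ge0.
have ts1 : t * s <= s by rewrite ler_piMl.
apply: le_trans (cabs_le_ReIm _) _.
suff [h1 h2] : `|complex.Re (z - x +i* y)| <= s /\ `|complex.Im (z - x +i* y)| <= s.
  by rewrite mulr2n mulrDl mul1r lerD.
rewrite !ler_norml.
case: hz => -> /=; split; rewrite !(mulr0, mul0r, mul1r, mulr1, subr0, addr0, add0r, oppr0); lra.
Qed.

(** Bisection: a bad square contains bad squares of side s / 2 ^ m with
    tolerance e / 4 ^ m, shrinking to a point. Near that point u is affine up to
    an error o(s / 2 ^ m), and affine functions have vanishing sums, so the sums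
    are o(4 ^ - m), a contradiction. *)
Theorem goursat u a s e : entire1 u -> 0 < s -> 0 < e -> ~ bad_square u a s e.
Proof.
move=> du s0 e0 bad0.
pose sub (p : C) m (b : bool * bool) : C :=
  p + (if b.1 then (s / 2 ^+ m.+1)%:C else 0)
    + (if b.2 then 'i * (s / 2 ^+ m.+1)%:C else 0).
have step (p : C) m : {b | bad_square u p (s / 2 ^+ m) (e / 4 ^+ m) ->
    bad_square u (sub p m b) (s / 2 ^+ m.+1) (e / 4 ^+ m.+1)}.
  apply: cid; have [bad|nb] := pselect (bad_square u p (s / 2 ^+ m) (e / 4 ^+ m)).
    have [b hb] := bad_square_halve bad; exists b => _; move: hb; rewrite /sub.
    have -> : s / 2 ^+ m / 2 = s / 2 ^+ m.+1 by rewrite exprS invfM; ring.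
    by have -> : e / 4 ^+ m / 4 = e / 4 ^+ m.+1 by rewrite exprS invfM; ring.
  by exists (true, true).
pose fix c m : C := if m is m'.+1 then sub (c m') m' (sval (step (c m') m')) else a.
have badc m : bad_square u (c m) (s / 2 ^+ m) (e / 4 ^+ m).
  elim: m => [|m IH]; first by rewrite !expr0 !divr1.
  exact: (svalP (step (c m) m)).
have half m : s / 2 ^+ m.+1 = s / 2 ^+ m / 2 by rewrite exprS invfM; ring.
have pos m : 0 < s / 2 ^+ m by rewrite divr_gt0 // exprn_gt0.
have [x hx] : exists x, forall m, complex.Re (c m) <= x <= complex.Re (c m) + s / 2 ^+ m.
  apply: nested_point => // m /=; rewrite /sub.
  case: (sval _) => b1 b2 /=; have := pos m; rewrite half.
  case: (c m) => p q; case: b1; case: b2 => /=;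
    rewrite !(mulr0, mul0r, mul1r, mulr1, subr0, addr0, add0r, oppr0); lra.
have [y hy] : exists y, forall m, complex.Im (c m) <= y <= complex.Im (c m) + s / 2 ^+ m.
  apply: nested_point => // m /=; rewrite /sub.
  case: (sval _) => b1 b2 /=; have := pos m; rewrite half.
  case: (c m) => p q; case: b1; case: b2 => /=;
    rewrite !(mulr0, mul0r, mul1r, mulr1, subr0, addr0, add0r, oppr0); lra.
pose z0 := x +i* y.
have /cderiv_atP[k hk] := du z0.
(* Four sides, error at most eps times the distance 2 s_m: the total is
   8 eps s_m ^ 2, and this eps makes it e / 4 ^ m. *)
have [|r r0 hr] := hk (e / (8 * s ^+ 2)); first by rewrite divr_gt0 // mulr_gt0 // exprn_gt0.
have [m hm] : exists m, 2 * (s / 2 ^+ m) < r.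
  have [m] := ltr_add_invr (divr_gt0 r0 (mulr_gt0 (ltr0Sn R 1) s0)).
  rewrite add0r ltr_pdivlMr ?mulr_gt0 // mulrC ltr_pdivrMr ?ltr0Sn // => hm.
  exists m; rewrite mulrA ltr_pdivrMr ?exprn_gt0 //.
  apply: lt_le_trans hm _; rewrite ler_pM2l // -natrX ler_nat.
  exact: ltn_expl.
have [n _] := badc m 0%N; apply/negP; rewrite -leNgt.
pose sm := s / 2 ^+ m; pose err z := u z + (-1) * ((u z0 - k * z0) + k * z).
have -> : square_sum n u (c m) sm%:C = square_sum n err (c m) sm%:C.
  by rewrite /err square_sumD square_sumZ square_sum_affine mulr0 addr0.
apply: le_trans (@cabs_square_sum n _ _ _ (e / (8 * s ^+ 2) * (2 * sm)) _) _.
  move=> z /(on_square_edge_near (ltW (pos m)) (hx m) (hy m)) hz.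
  have -> : err z = u z - u z0 - k * (z - z0) by rewrite /err; ring.
  apply: le_trans (hr z (le_lt_trans hz hm)) _.
  by rewrite ler_wpM2l // ltW // divr_gt0 // mulr_gt0 // exprn_gt0.
rewrite cabs_real gtr0_norm ?pos // /sm le_eqVlt; apply/orP; left; apply/eqP.
have -> : (4 ^+ m : R) = 2 ^+ m * 2 ^+ m by rewrite -exprMn; congr (_ ^+ _); ring.
by field; rewrite ?(gt_eqF s0) //= ?expf_neq0 // ?pnatr_eq0.
Qed.

End Goursat.



(** * Continuity and difference quotients *)

Section Continuity.
Variable R : realType.
Local Notation C := R[i].
Implicit Types (u g h : C -> C) (a b v p : C).

(** The regular-module structure is fixed once here, so that both sides of the
    limit use the same topology. *)
Definition cont_at (g : C -> C) (a : C) : Prop :=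
  (g : C^o -> C^o) @ (a : C^o) --> (g a : C^o).

Lemma cont_atP g a : cont_at g a <->
  forall e : R, 0 < e -> exists2 r : R, 0 < r &
    forall z, cabs (z - a) < r -> cabs (g z - g a) <= e.
Proof.
split=> [/cvgrPdist_le hc e e0|hc].
  have /hc : (0 : C) < e%:C by rewrite ltcR.
  move=> /nbhs_ballP[/= r r0 hr].
  have := r0; rewrite ltcE /= => /andP[/eqP rI r0'].
  exists (complex.Re r) => // z hz.
  have := hr z; rewrite /ball /= normc_cabs.
  rewrite (cabsC a z).
  have -> : r = (complex.Re r)%:C by case: r rI {r0 r0' hr hz} => x y /= ->.
  by rewrite ltcR => /(_ hz); rewrite lecR cabsC.
apply: (proj2 (@cvgrPdist_le C C^o C^o _ (@nbhs_filter C^o a) g (g a))) => e; rewrite ltcE /= => /andP[/eqP eI e0].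
have -> : e = (complex.Re e)%:C by case: (e) eI => x y /= ->.
have [r r0 hr] := hc _ e0.
apply/nbhs_ballP; exists r%:C; first by rewrite /= ltcR.
move=> z; rewrite /ball /= normc_cabs ltcR cabsC => /hr.
by rewrite normc_cabs lecR cabsC.
Qed.

Lemma cont_atM g h a : cont_at g a -> cont_at h a -> cont_at (fun z => g z * h z) a.
Proof. by move=> hg hh; exact (cvgM hg hh). Qed.

Lemma cont_atV g a : cont_at g a -> g a != 0 -> cont_at (fun z => (g z)^-1) a.
Proof. by move=> hg ga; exact (cvgV ga hg). Qed.

Lemma cont_at_comp g h a : cont_at g (h a) -> cont_at h a -> cont_at (fun z => g (h z)) a.
Proof. by move=> hg hh; exact (@cvg_comp C^o C^o C^o h g (nbhs (a : C^o)) (nbhs (h a : C^o))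
  (nbhs (g (h a) : C^o)) hh hg). Qed.

Lemma differentiable_cont_at g a :
  differentiable (g : C^o -> C^o) (a : C^o) -> cont_at g a.
Proof. by move=> dg; exact: (@differentiable_continuous C C^o C^o). Qed.

(** Caratheodory's form of differentiability: the difference quotient extends
    continuously to a. It turns the removal of singularities of quotients into
    algebra on the slopes. *)
Lemma cderiv_slope g a c : cderiv_at g a c ->
  exists phi : C -> C, [/\ cont_at phi a, phi a = c &
    forall z, g z = g a + phi z * (z - a)].
Proof.
move=> hc; exists (fun z => if z == a then c else (g z - g a) / (z - a)).
split; last 2 first.
- by rewrite eqxx.
- move=> z; have [->|za] := eqVneq z a; first by rewrite subrr mulr0 addr0.
  by rewrite divfK ?subr_eq0 // addrC subrK.
apply/cont_atP => e e0; have [r r0 hr] := hc _ e0; exists r => // z hz.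
rewrite eqxx; have [_|za] := eqVneq z a.
  by rewrite subrr cabs0 ltW.
have zna : z - a != 0 by rewrite subr_eq0.
have -> : (g z - g a) / (z - a) - c = (z - a)^-1 * (g z - g a - c * (z - a)).
  by field.
by rewrite cabsM cabsV ler_pdivrMl ?cabs_gt0 // [cabs _ * e]mulrC; exact: hr.
Qed.

Lemma slope_cderiv g a (phi : C -> C) : cont_at phi a ->
  (forall z, g z = g a + phi z * (z - a)) -> cderiv_at g a (phi a).
Proof.
move=> /cont_atP hphi hg e e0; have [r r0 hr] := hphi _ e0; exists r => // z hz.
have -> : g z - g a - phi a * (z - a) = (phi z - phi a) * (z - a) by rewrite (hg z); ring.
by rewrite cabsM ler_wpM2r ?cabs_ge0 //; exact: hr.
Qed.

Lemma caratheodory g a : differentiable (g : C^o -> C^o) (a : C^o) <->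
  exists2 phi : C -> C, cont_at phi a &
    forall z, g z = g a + phi z * (z - a).
Proof.
rewrite cderiv_atP; split=> [[c /cderiv_slope[phi [? _ ?]]]|[phi ? ?]].
  by exists phi.
by exists (phi a); exact: slope_cderiv.
Qed.

(** Squaring makes the singularity at a harmless without knowing that g is
    analytic: if phi is the slope of g at a, the quotient is
    phi z ^ 2 (z - a), which is visibly differentiable at a. *)
Lemma sqr_quot_entire g a : entire1 g -> entire1 (fun z => (g z - g a) ^+ 2 / (z - a)).
Proof.
move=> dg b; have [->|ba] := eqVneq b a; last first.
  apply: differentiable_mul1.
    by apply: differentiable_exp1; apply: entire1B => //; exact: entire1_cst.
  apply: differentiable_inv1; last by rewrite subr_eq0.
  by apply: entire1B; [exact: entire1_id|exact: entire1_cst].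
have /caratheodory[phi cphi hphi] := dg a.
apply/caratheodory; exists (fun z => phi z * phi z); first exact: cont_atM.
move=> z; rewrite subrr expr0n mul0r add0r (hphi z) [g a + _]addrC addrK.
have [->|za] := eqVneq z a; first by rewrite subrr !mulr0 invr0 mulr0.
by rewrite exprMn !expr2 !mulrA mulfK ?subr_eq0.
Qed.

Lemma entire1_continuous_segment g p v : entire1 g ->
  continuous (fun t : R => cabs (g (p + t%:C * v))).
Proof.
move=> dg t; apply/cvgrPdist_le => e e0.
have /cont_atP/(_ e e0)[r r0 hr] :
    cont_at g (p + t%:C * v).
  exact: (@differentiable_continuous C C^o C^o).
have d0 : 0 < r / (cabs v + 1) by rewrite divr_gt0 // ltr_wpDl ?cabs_ge0.
apply/nbhs_ballP; exists (r / (cabs v + 1)) => //= t'; rewrite /ball /= => ht.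
have := hr (p + t'%:C * v).
have -> : p + t'%:C * v - (p + t%:C * v) = (t' - t)%:C * v by rewrite rmorphB; ring.
rewrite cabsM cabs_real distrC => /(_ _) /wrap[].
  apply: le_lt_trans (_ : _ <= `|t - t'| * (cabs v + 1)) _.
    by rewrite ler_wpM2l // lerDl.
  by rewrite -ltr_pdivlMr // ltr_wpDl ?cabs_ge0.
move=> h; rewrite ler_norml; apply/andP; split.
  have := cabs_le_add (g (p + t'%:C * v)) (g (p + t%:C * v)); lra.
have := cabs_le_add (g (p + t%:C * v)) (g (p + t'%:C * v)).
by rewrite cabsC; lra.
Qed.

Lemma entire1_bounded_segment g p v : entire1 g ->
  exists M, forall t : R, 0 <= t <= 1 -> cabs (g (p + t%:C * v)) <= M.
Proof.
move=> dg; have /continuous_subspaceT cg := entire1_continuous_segment (p := p) (v := v) dg.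
have [c _ hc] := EVT_max (@ler01 R) (cg _).
by exists (cabs (g (p + c%:C * v))) => t t01; apply: hc; rewrite in_itv.
Qed.

Lemma entire1_bounded_square g a v : entire1 g ->
  exists2 M, 0 <= M & forall z, on_square_edge a v z -> cabs (g z) <= M.
Proof.
move=> dg.
have [M1 h1] := entire1_bounded_segment a v dg.
have [M2 h2] := entire1_bounded_segment (a + 'i * v) v dg.
have [M3 h3] := entire1_bounded_segment a ('i * v) dg.
have [M4 h4] := entire1_bounded_segment (a + v) ('i * v) dg.
have pos M p w : (forall t : R, 0 <= t <= 1 -> cabs (g (p + t%:C * w)) <= M) -> 0 <= M.
  by move=> /(_ 0); rewrite lexx ler01 => /(_ isT); apply: le_trans; exact: cabs_ge0.
have p1 := pos _ _ _ h1; have p2 := pos _ _ _ h2.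
have p3 := pos _ _ _ h3; have p4 := pos _ _ _ h4.
exists (M1 + M2 + M3 + M4); first by lra.
move=> z [t t01 [] ->].
- by have := h1 t t01; lra.
- by have := h2 t t01; lra.
- by have := h3 t t01; lra.
- by have := h4 t t01; lra.
Qed.

End Continuity.



(** * Cauchy's estimate, Liouville's theorem and the identity theorem *)

Section Consequences.
Variable R : realType.
Local Notation C := R[i].
Implicit Types (u g h : C -> C) (a b v p : C).

Lemma unit_edge_ge1 z : on_square_edge (-1 - 'i) (2 : R)%:C z -> 1 <= cabs z.
Proof.
move=> [t _ hz].
suff : 1 <= `|complex.Re z| \/ 1 <= `|complex.Im z|.
  by case=> /le_trans; apply; [exact: Re_le_cabs|exact: Im_le_cabs].
case: hz => -> /=; rewrite !(mulr0, mul0r, mul1r, mulr1, subr0, sub0r, addr0, add0r, oppr0).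
- by right; rewrite normrN normr1.
- by right; rewrite ler_normr; apply/orP; left; lra.
- by left; rewrite normrN normr1.
- by left; rewrite ler_normr; apply/orP; left; lra.
Qed.

Lemma Im_edge_sumB n u p q v (m : R) :
  (forall t : R, 0 <= t <= 1 ->
     m <= complex.Im ((u (p + t%:C * v) - u (q + t%:C * v)) * v)) ->
  m <= complex.Im (edge_sum n u p v - edge_sum n u q v).
Proof.
move=> h; have N0 : (0 : R) < 2 ^+ n by rewrite exprn_gt0.
have e2 : (2 ^+ n : C) = (2 ^+ n : R)%:C by rewrite rmorphXn /= rmorph_nat.
rewrite /edge_sum -sumrB.
have Im_sum (I : Type) (r : seq I) (F : I -> C) :
    complex.Im (\sum_(i <- r) F i) = \sum_(i <- r) complex.Im (F i).
  by apply: (big_morph (@complex.Im R)) => // -[? ?] [? ?].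
rewrite Im_sum.
have -> : m = \sum_(j < 2 ^ n) m / 2 ^+ n.
  by rewrite sumr_const card_ord -[_ *+ _]mulr_natr natrX; field; rewrite gt_eqF.
apply: ler_sum => j _.
rewrite -mulrBl mulrA e2.
have -> : (j%:R / (2 ^+ n : R)%:C : C) = (j%:R / 2 ^+ n : R)%:C.
  by rewrite rmorphM /= fmorphV rmorph_nat.
have /h : 0 <= (j%:R / 2 ^+ n : R) <= 1.
  rewrite divr_ge0 ?ler0n ?(ltW N0) //= ler_pdivrMr // mul1r -natrX ler_nat.
  exact: ltnW (ltn_ord j).
have -> : ((2 ^+ n : R)%:C : C)^-1 = ((2 ^+ n : R)^-1)%:C by rewrite fmorphV.
by set w := _ * v; case: w => wr wi hw; rewrite /= mulr0 add0r ler_pM2r ?invr_gt0.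
Qed.

(** This replaces the value 2 pi 'i of the integral of 1 / z. Pairing opposite
    points of opposite edges shows that each of the two pairs contributes an
    imaginary part of at least 2. *)
Lemma square_sum_inv n :
  4 <= cabs (square_sum n (fun z => z^-1) (-1 - 'i) (2 : R)%:C).
Proof.
apply: le_trans (Im_le_cabs _); apply: le_trans (ler_norm _).
rewrite /square_sum; set e1 := edge_sum _ _ _ _; set e2 := edge_sum _ _ _ _.
set e3 := edge_sum _ _ _ _; set e4 := edge_sum _ _ _ _.
have -> : e1 + e2 - e3 - e4 = (e1 - e3) + (e2 - e4) by ring.
have h x : 0 <= x <= 1 -> 2 <= 4 / ((2 * x - 1) ^+ 2 + 1) :> R.
  move=> /andP[x0 x1]; rewrite ler_pdivlMr; last by nra.
  by nra.
have h13 : 2 <= complex.Im (e1 - e3).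
  apply: Im_edge_sumB => t /h ht; apply: le_trans ht _.
  rewrite le_eqVlt; apply/orP; left; apply/eqP => /=.
  rewrite !(mulr0, mul0r, mul1r, mulr1, subr0, sub0r, addr0, add0r, oppr0).
  field; have pos (y : R) : y ^+ 2 + 1 != 0 by rewrite gt_eqF // ltr_wpDl ?sqr_ge0. by rewrite ?[1 + _]addrC !pos.
have h24 : 2 <= complex.Im (e2 - e4).
  apply: Im_edge_sumB => t /h ht; apply: le_trans ht _.
  rewrite le_eqVlt; apply/orP; left; apply/eqP => /=.
  rewrite !(mulr0, mul0r, mul1r, mulr1, subr0, sub0r, addr0, add0r, oppr0).
  field; have pos (y : R) : y ^+ 2 + 1 != 0 by rewrite gt_eqF // ltr_wpDl ?sqr_ge0. by rewrite ?[1 + _]addrC !pos.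
move: h13 h24; case: (e1 - e3) => ? ?; case: (e2 - e4) => ? ? /=; lra.
Qed.

(** The sums of (g z - g 0) ^ 2 / z tend to 0, so g 0 ^ 2 times the sum of
    1 / z is comparable to the sum of (g z ^ 2 - 2 g 0 g z) / z. With x = |g 0|
    this gives 4 x ^ 2 <= 8 (M ^ 2 + 2 x M), which fails if x > 5 M. *)
Lemma cauchy_bound_unit g M : entire1 g ->
  (forall z, on_square_edge (-1 - 'i) (2 : R)%:C z -> cabs (g z) <= M) ->
  cabs (g 0) <= 5 * M.
Proof.
move=> dg hM.
have M0 : 0 <= M.
  apply: le_trans (cabs_ge0 (g (-1 - 'i))) (hM _ _).
  by exists 0; rewrite ?lexx ?ler01 //; constructor 1; rewrite mul0r addr0.
rewrite leNgt; apply/negP => lt.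
set x := cabs (g 0) in lt.
pose e := (4 * x ^+ 2 - 16 * (M * x) - 8 * M ^+ 2) / 2.
have e0 : 0 < e by rewrite /e divr_gt0 //; nra.
pose u z := (g z - g 0) ^+ 2 / (z - 0).
have du : entire1 u := sqr_quot_entire 0 dg.
apply: (@goursat _ u (-1 - 'i) 2 e du (ltr0Sn R 1) e0) => N; exists N => //.
pose w z := (g z * g z - 2 * g 0 * g z) / z.
have -> : square_sum N u (-1 - 'i) (2 : R)%:C = square_sum N w (-1 - 'i) (2 : R)%:C
    + (g 0) ^+ 2 * square_sum N (fun z => z^-1) (-1 - 'i) (2 : R)%:C.
  rewrite -square_sumZ -square_sumD; apply: eq_square_sum => z.
  by rewrite /u /w subr0 -mulrDl; congr (_ / _); ring.
have hw : cabs (square_sum N w (-1 - 'i) (2 : R)%:C) <= 4 * (2 * (M * M + 2 * x * M)).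
  have := @cabs_square_sum _ N w (-1 - 'i) (2 : R)%:C (M * M + 2 * x * M).
  rewrite cabs_real ger0_norm // => -> // z hz.
  rewrite /w cabsM cabsV ler_pdivrMr; last exact: lt_le_trans ltr01 (unit_edge_ge1 hz).
  apply: (@le_trans _ _ (M * M + 2 * x * M)).
    apply: le_trans (cabsB _ _) _; rewrite !cabsM cabs_nat -/x.
    by rewrite lerD ?ler_pM ?mulr_ge0 ?cabs_ge0 ?hM.
  by rewrite ler_peMr ?unit_edge_ge1 // addr_ge0 ?mulr_ge0 ?cabs_ge0.
have hi := square_sum_inv N.
set s1 := square_sum _ _ _ _ in hw *; set s2 := square_sum _ _ _ _ in hi *.
have := cabs_le_add (g 0 ^+ 2 * s2) (s1 + g 0 ^+ 2 * s2).
rewrite opprD addrCA subrr addr0 cabsN cabsM cabsX -/x => h.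
have h2 : x ^+ 2 * 4 <= x ^+ 2 * cabs s2 by rewrite ler_wpM2l ?exprn_ge0 ?cabs_ge0.
by rewrite /e in e0 *; nra.
Qed.

(** The boundary of the square with centre b and half side L. *)
Definition on_box b (L : R) z :=
  (`|complex.Re (z - b)| = L /\ `|complex.Im (z - b)| <= L) \/
  (`|complex.Im (z - b)| = L /\ `|complex.Re (z - b)| <= L).

Lemma on_box_ge b L z : on_box b L z -> L <= cabs (z - b).
Proof. by case=> -[<- _]; [exact: Re_le_cabs|exact: Im_le_cabs]. Qed.

Lemma unit_edge_on_box b L z : 0 <= L ->
  on_square_edge (-1 - 'i) (2 : R)%:C z -> on_box b L (b + L%:C * z).
Proof.
move=> L0 [t /andP[t0 t1]] hz; rewrite /on_box [b + _]addrC addrK.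
suff : (`|complex.Re z| = 1 /\ `|complex.Im z| <= 1) \/
       (`|complex.Im z| = 1 /\ `|complex.Re z| <= 1).
  case: (z) => x y /=; rewrite !mul0r subr0 addr0 !normrM (ger0_norm L0).
  by case=> -[-> h]; [left|right]; rewrite mulr1 ler_piMr.
case: hz => -> /=; rewrite !(mulr0, mul0r, mul1r, mulr1, subr0, sub0r, addr0, add0r, oppr0).
- by right; rewrite normrN normr1 ler_norml; split => //; apply/andP; split; lra.
- right; rewrite ler_norml; split; last by apply/andP; split; lra.
  by rewrite (_ : -1 + 2 = 1) ?normr1 //; lra.
- by left; rewrite normrN normr1 ler_norml; split => //; apply/andP; split; lra.
- left; rewrite ler_norml; split; last by apply/andP; split; lra.
  by rewrite (_ : -1 + 2 = 1) ?normr1 //; lra.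
Qed.

(** By rescaling to the square with corners -1 - 'i and 1 + 'i. *)
Theorem cauchy_bound g b L M : entire1 g -> 0 <= L ->
  (forall z, on_box b L z -> cabs (g z) <= M) -> cabs (g b) <= 5 * M.
Proof.
move=> dg L0 hM.
have := @cauchy_bound_unit (fun z => g (b + L%:C * z)) M.
rewrite mulr0 addr0; apply.
  apply: (entire1_comp dg); apply: entire1D; first exact: entire1_cst.
  by apply: entire1M; [exact: entire1_cst|exact: entire1_id].
by move=> z hz; apply: hM; exact: unit_edge_on_box.
Qed.

Lemma le_arch_eq0 (x A : R) : 0 <= x -> (forall n : nat, x * n.+1%:R <= A) -> x = 0.
Proof.
move=> x0 h; apply/eqP; rewrite eq_le x0 andbT leNgt; apply/negP => xp.
have A0 : 0 < A by apply: lt_le_trans (h 0%N); rewrite mulr1.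
have [n] := ltr_add_invr (divr_gt0 xp A0); rewrite add0r => hn.
have := h n; apply/negP; rewrite -ltNge -ltr_pdivrMr ?ltr0Sn //.
by move: hn; rewrite ltr_pdivlMr // mulrC.
Qed.

(** The function (g z - g a) ^ 2 / (z - a) is entire and tends to 0 on large
    boxes, so it vanishes at b by [cauchy_bound]. A bound on a sequence of boxes
    is enough, and [periodic_trig_poly] needs this freedom. *)
Theorem liouville g b M : entire1 g ->
  (forall L0, exists2 L : R, L0 <= L & forall z, on_box b L z -> cabs (g z) <= M) ->
  forall a, g a = g b.
Proof.
move=> dg hM a; have [->//|ab] := eqVneq a b.
pose D := (g b - g a) ^+ 2 / (b - a).
have M0 : 0 <= M.
  have [L L0 /(_ (b + L%:C))] := hM 0; rewrite /on_box [b + _]addrC addrK /=.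
  by rewrite normr0 ger0_norm // => /(_ (or_introl (conj erefl L0))); apply: le_trans; exact: cabs_ge0.
suff : cabs D = 0.
  move/eqP; rewrite cabs_eq0 mulf_eq0 invr_eq0 [b - a == 0]subr_eq0 [b == a]eq_sym (negPf ab) orbF.
  by rewrite expf_eq0 /= subr_eq0 => /eqP.
apply: (@le_arch_eq0 _ (5 * (M + cabs (g a)) ^+ 2)); first exact: cabs_ge0.
move=> n; have [L L0 hL] := hM (cabs (a - b) + n.+1%:R).
have n0 : (0 : R) < n.+1%:R by rewrite ltr0Sn.
have LL : 0 <= L by apply: le_trans L0; rewrite addr_ge0 ?cabs_ge0 ?ltW.
rewrite -ler_pdivlMr // -mulrA.
apply: (cauchy_bound (L := L) (sqr_quot_entire a dg)) => // z hz.
have hza : n.+1%:R <= cabs (z - a).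
  have := cabs_le_add (z - b) (z - a); have := on_box_ge hz.
  have -> : z - b - (z - a) = a - b by ring.
  lra.
rewrite cabsM cabsX cabsV; apply: ler_pM; rewrite ?exprn_ge0 ?invr_ge0 ?cabs_ge0 //.
  apply: lerXn2r; rewrite ?nnegrE ?cabs_ge0 ?addr_ge0 ?cabs_ge0 //.
  by apply: le_trans (cabsB _ _) _; rewrite lerD2r hL.
by rewrite lef_pV2 // posrE //; exact: lt_le_trans hza.
Qed.

Lemma entire1_bounded_box g b L : entire1 g -> 0 <= L ->
  exists2 M, 0 <= M & forall z, on_box b L z -> cabs (g z) <= M.
Proof.
move=> dg L0.
have [M M0 hM] := entire1_bounded_square (b - L%:C - 'i * L%:C) (2 * L)%:C dg.
exists M => // z hz; apply: hM.
have [L0'|Lp] := eqVneq L 0.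
  have /eqP : z - b = 0.
    move: hz; rewrite L0' /on_box; case: (z - b) => x y /=.
    by rewrite !normr_le0 => -[[/eqP]|[/eqP]]; rewrite normr_eq0 => /eqP-> /eqP->.
  rewrite subr_eq0 => /eqP ->; exists 0; rewrite ?lexx ?ler01 //; constructor 1.
  by rewrite L0' mulr0 !subr0 mul0r addr0.
have {}Lp : 0 < L by rewrite lt_def Lp.
have zE : z = b + (z - b) by rewrite addrC subrK.
rewrite {}zE; move: hz; rewrite /on_box; case: (z - b) => x y /=; rewrite !ler_norml.
have tE (w : R) : - L <= w <= L -> exists2 t, 0 <= t <= 1 & w = - L + t * (2 * L).
  move=> /andP[w1 w2]; exists ((w + L) / (2 * L)).
    by rewrite divr_ge0 ?ler_pdivrMr ?mul1r //=; lra.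
  by field; rewrite gt_eqF.
move: b => -[p q].
have absE (w : R) : `|w| = L -> w = L \/ w = - L.
  by move=> <-; case: (ler0P w) => _; [right; rewrite opprK|left].
case=> -[/absE hx /tE[t t01 ->]]; exists t => //.
- case: hx => ->; [constructor 4|constructor 3]; apply/eqP; rewrite eq_complex /=;
  apply/andP; split; apply/eqP; ring.
- case: hx => ->; [constructor 2|constructor 1]; apply/eqP; rewrite eq_complex /=;
  apply/andP; split; apply/eqP; ring.
Qed.

(** If g vanishes near 0 then so does g z / z ^ n, which is therefore entire for
    every n. Let M bound |g| on the boundary of the box around b of half
    side 3 |b|. There |z| >= 2 |b|, so the quotient is at most M / (2 |b|) ^ n and [cauchy_bound] gives |g b| <= 5 M / 2 ^ n. *)
Lemma entire1_identity g (r : R) : entire1 g -> 0 < r ->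
  (forall z, cabs z < r -> g z = 0) -> forall z, g z = 0.
Proof.
move=> dg r0 g0 b.
have [/g0 //|rb] := ltP (cabs b) r.
have b0 : 0 < cabs b by exact: lt_le_trans rb.
have dgn n : entire1 (fun z => g z * z^-1 ^+ n).
  move=> a; have [->|a0] := eqVneq a 0; last first.
    apply: differentiable_mul1; first exact: dg.
    by apply: differentiable_exp1; apply: differentiable_inv1 => //; exact: entire1_id.
  apply/cderiv_atP; exists 0 => e e0; exists r => // z; rewrite subr0 => /g0 ->.
  by rewrite !mul0r g0 ?cabs0 // mul0r subrr subr0 cabs0 mulr_ge0 ?cabs_ge0 ?ltW.
have [M M0 hM] := entire1_bounded_box b dg (mulr_ge0 (ler0n _ 3) (ltW b0)).
apply/eqP; rewrite -cabs_eq0; apply/eqP.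
apply: (@le_arch_eq0 _ (5 * M)); first exact: cabs_ge0.
move=> n.
have : cabs (g b * b^-1 ^+ n.+1) <= 5 * (M * (2 * cabs b)^-1 ^+ n.+1).
  apply: (cauchy_bound (dgn _) (mulr_ge0 (ler0n _ 3) (ltW b0))) => z hz.
  rewrite cabsM cabsX cabsV ler_pM ?exprn_ge0 ?invr_ge0 ?cabs_ge0 ?hM //.
  have hz2 : 2 * cabs b <= cabs z.
    by have := cabs_le_add (z - b) z; have := on_box_ge hz;
       have -> : z - b - z = - b by [ring|]; rewrite cabsN; lra.
  apply: lerXn2r; rewrite ?nnegrE ?invr_ge0 ?cabs_ge0 ?mulr_ge0 ?cabs_ge0 //.
  by rewrite lef_pV2 // posrE ?mulr_gt0 //; apply: lt_le_trans hz2; rewrite mulr_gt0.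
rewrite cabsM cabsX cabsV invfM exprMn 2!mulrA ler_pM2r ?exprn_gt0 ?invr_gt0 //.
rewrite exprVn ler_pdivlMr ?exprn_gt0 //; apply: le_trans.
rewrite ler_wpM2l ?cabs_ge0 // -natrX ler_nat.
by apply: ltnW; exact: ltn_expl.
Qed.

End Consequences.



(** * The exponential e2pi *)

Section Exponential.
Variable R : realType.
Local Notation C := R[i].
Implicit Types (z w : C).
Local Notation e2pi := (@e2pi R).

Lemma e2piE (x y : R) : e2pi (x +i* y) =
  (expR (- (2 * pi * y)) * cos (2 * pi * x)) +i*
  (expR (- (2 * pi * y)) * sin (2 * pi * x)).
Proof. by rewrite /Defs.e2pi /cexp /= !mul0r sub0r add0r. Qed.

Lemma cabs_e2pi z : cabs (e2pi z) = expR (- (2 * pi * complex.Im z)).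
Proof.
case: z => x y; rewrite e2piE /= !exprMn -mulrDr cos2Dsin2 mulr1 sqrtr_sqr.
by rewrite ger0_norm ?expR_ge0.
Qed.

Lemma e2pi_neq0 z : e2pi z != 0.
Proof. by rewrite -cabs_gt0 cabs_e2pi expR_gt0. Qed.

Lemma e2piN z : e2pi (- z) = (e2pi z)^-1.
Proof.
by apply: (mulfI (e2pi_neq0 z)); rewrite -e2piD subrr e2pi0 divff ?e2pi_neq0.
Qed.

Lemma e2piX z n : e2pi (n%:R * z) = e2pi z ^+ n.
Proof.
elim: n => [|n IH]; first by rewrite mul0r e2pi0.
by rewrite -natr1 mulrDl mul1r e2piD IH exprSr.
Qed.

Lemma e2pi1 : e2pi 1 = 1.
Proof.
rewrite [1 : C](_ : _ = 1 +i* 0) // e2piE mulr0 oppr0 expR0 !mul1r mulr1.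
by rewrite mulr_natl cos2pi sin2pi.
Qed.

Lemma e2pi_nat n : e2pi n%:R = 1.
Proof. by rewrite -[_%:R]mulr1 e2piX e2pi1 expr1n. Qed.

Lemma e2pi_int (m : int) : e2pi m%:~R = 1.
Proof.
case: m => n; first exact: e2pi_nat.
by rewrite NegzE mulrNz e2piN -pmulrn e2pi_nat invr1.
Qed.

Lemma e2pi_eq1 z : e2pi z = 1 -> exists m : int, z = m%:~R.
Proof.
move=> h; have := cabs_e2pi z; rewrite h cabs1 => /esym.
rewrite -[X in _ = X]expR0 => /expR_inj/eqP.
have p0 : 2 * pi != 0 :> R by rewrite gt_eqF // mulr_gt0 // pi_gt0.
rewrite oppr_eq0 mulf_eq0 (negPf p0) /= => /eqP zI.
case: z zI h => x y /= ->; rewrite e2piE mulr0 oppr0 expR0 !mul1r => -[cx _].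
exists (Num.floor x).
have /andP[x1] := floor_itv x; rewrite intrD => x2.
set m := Num.floor x in x1 x2 *; pose f := x - m%:~R.
have : e2pi (f +i* 0) = 1.
  rewrite /f (_ : _ +i* _ = x +i* 0 + (- m)%:~R); last first.
    rewrite (_ : (- m)%:~R = ((- m)%:~R : R)%:C); last by rewrite rmorph_int.
    by rewrite mulrNz; simpc.
  rewrite e2piD e2pi_int mulr1 e2piE mulr0 oppr0 expR0 !mul1r cx.
  have := sin2cos2 (2 * pi * x); rewrite cx expr1n subrr => /eqP.
  by rewrite expf_eq0 /= => /eqP ->.
rewrite e2piE mulr0 oppr0 expR0 !mul1r => -[cf _].
have : sin (pi * f) = 0.
  move: cf; rewrite -mulrA mulr_natl cos_mulr2n => cf.
  have := sin2cos2 (pi * f); have -> : 1 - cos (pi * f) ^+ 2 = 0 by lra.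
  by move/eqP; rewrite expf_eq0 /= => /eqP.
have [f0|f0|f0] := ltgtP 0 f.
- move=> s0; have : 0 < sin (pi * f).
    apply: sin_gt0_pi; rewrite mulr_gt0 ?pi_gt0 //= gtr_pMr ?pi_gt0 //.
    by rewrite /f; lra.
  by rewrite s0 ltxx.
- by exfalso; move: f0; rewrite /f; lra.
- move=> _; rewrite (_ : m%:~R = (m%:~R : R)%:C); last by rewrite rmorph_int.
  by congr (_ +i* _); apply/eqP; rewrite -subr_eq0 -/f -f0.
Qed.

Lemma e2pi_div_eq1 (a : int) (q : nat) : (0 < q)%N ->
  e2pi (a%:~R / q%:R) = 1 -> (q%:Z %| a)%Z.
Proof.
move=> q0 /e2pi_eq1[m /eqP]; have q0' : (q%:R : C) != 0 by rewrite pnatr_eq0 -lt0n.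
rewrite -subr_eq0 -[X in _ - X](mulfK q0') -mulrBl mulf_eq0 invr_eq0 (negPf q0') orbF.
rewrite -[q%:R]/(q%:Z%:~R) -intrM subr_eq0 eqr_int => /eqP ->.
exact: dvdz_mull.
Qed.

End Exponential.

Section ExponentialEntire.
Variable R : realType.
Local Notation C := R[i].

Lemma real_deriv_eps (g : R -> R) (a c : R) : is_derive a 1 g c ->
  forall e : R, 0 < e -> exists2 r : R, 0 < r &
    forall x, `|x - a| < r -> `|g x - g a - c * (x - a)| <= e * `|x - a|.
Proof.
move=> [/cvg_ex[/= c' hc'] Dg] e e0.
have cc : c' = c by rewrite -Dg; apply/esym; exact: cvg_lim hc'.
move: hc'; rewrite cc => /cvgrPdist_le/(_ e e0).
rewrite near_withinE => /nbhs_ballP[/= r r0 hr]; exists r => // z hz.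
have [->|za] := eqVneq z a; first by rewrite !subrr mulr0 subr0 normr0 mulr0.
have zna : z - a != 0 by rewrite subr_eq0.
have := hr (z - a); rewrite /ball /= sub0r normrN => /(_ hz zna).
rewrite [(z - a)%:A]mulr1 subrK => h.
have -> : g z - g a - c * (z - a) = - (z - a) * (c - (z - a)^-1 *: (g z - g a)).
  by rewrite /GRing.scale /=; field.
by rewrite normrM normrN mulrC ler_wpM2r.
Qed.

(** By the real first-order expansions of exp, cos and sin at 0. *)
Lemma cexp_cderiv0 : cderiv_at (@cexp R) 0 1.
Proof.
move=> e e0.
(* The real expansions are used with tolerance e' = min (1, e / 10); their
   contributions to the error add up to 9 e' |z|. *)
have [e' [e'0 e'1 e'e]] : exists e' : R, [/\ 0 < e', e' <= 1 & e' <= e / 10].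
  exists (Num.min 1 (e / 10)).
  by rewrite lt_min ltr01 divr_gt0 // !ge_min !lexx orbT.
have [r1 r10 h1] := real_deriv_eps (is_derive_expR (0 : R)) e'0.
have [r2 r20 h2] := real_deriv_eps (is_derive_sin (0 : R)) e'0.
have [r3 r30 h3] := real_deriv_eps (is_derive_cos (0 : R)) e'0.
exists (Num.min (Num.min r1 r2) (Num.min r3 e')).
  by rewrite !lt_min r10 r20 r30 e'0.
move=> z; rewrite subr0 !lt_min => /andP[/andP[z1 z2] /andP[z3 ze]].
have zR := Re_le_cabs z; have zI := Im_le_cabs z.
have N0 := cabs_ge0 z.
move: (cabs z) z1 z2 z3 ze zR zI N0 => N z1 z2 z3 ze.
case: z => x y zR zI N0; rewrite /= in zR zI.
have := h1 x; rewrite !subr0 expR0 mul1r => /(_ (le_lt_trans zR z1)) {}h1.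
have := h2 y; rewrite !subr0 cos0 sin0 mul1r subr0 => /(_ (le_lt_trans zI z2)) {}h2.
have := h3 y; rewrite !subr0 cos0 sin0 oppr0 mul0r subr0 => /(_ (le_lt_trans zI z3)) {}h3.
have eq : cexp (x +i* y) - cexp 0 - 1 * (x +i* y) =
  ((expR x - 1 - x) + expR x * (cos y - 1)) +i* (expR x * (sin y - y) + y * (expR x - 1)).
  rewrite cexp0 /cexp mul1r; apply/eqP; rewrite eq_complex /=; apply/andP; split; apply/eqP; ring.
rewrite eq; apply: le_trans (cabs_le_ReIm _) _ => /=.
have a1 : `|expR x - 1| <= 2 * `|x|.
  have := ler_normD (expR x - 1 - x) x; rewrite subrK.
  have := ler_wpM2r (normr_ge0 x) e'1; lra.
have E3 : expR x <= 3.
  have := ler_norm (expR x - 1); lra.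
have Ex0 := expR_ge0 x.
have b1 : `|expR x * (cos y - 1)| <= 3 * (e' * N).
  rewrite normrM (ger0_norm Ex0) ler_pM //.
  by apply: le_trans h3 _; rewrite ler_wpM2l // ltW.
have b2 : `|expR x * (sin y - y)| <= 3 * (e' * N).
  rewrite normrM (ger0_norm Ex0) ler_pM //.
  by apply: le_trans h2 _; rewrite ler_wpM2l // ltW.
have b3 : `|y * (expR x - 1)| <= N * (2 * e').
  by rewrite normrM ler_pM //; lra.
have b4 : e' * `|x| <= e' * N by rewrite ler_wpM2l // ltW.
have b5 : e' * N <= e / 10 * N by rewrite ler_wpM2r.
have eN : 0 <= e * N by rewrite mulr_ge0 // ltW.
have := ler_normD (expR x - 1 - x) (expR x * (cos y - 1)).
have := ler_normD (expR x * (sin y - y)) (y * (expR x - 1)).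
lra.
Qed.

Lemma cexp_entire : entire1 (@cexp R).
Proof.
move=> a; apply/cderiv_atP; exists (cexp a) => e e0.
have ca : 0 < cabs (cexp a) + 1 by rewrite ltr_wpDl ?cabs_ge0.
have [r r0 hr] := cexp_cderiv0 (divr_gt0 e0 ca).
exists r => // z hz; have := hr (z - a); rewrite subr0 => /(_ hz).
rewrite cexp0 mul1r => h.
have -> : cexp z - cexp a - cexp a * (z - a) = cexp a * (cexp (z - a) - 1 - (z - a)).
  have {1}-> : z = a + (z - a) by rewrite addrC subrK.
  by rewrite cexpD; ring.
rewrite cabsM; apply: le_trans (_ : cabs (cexp a) * (e / (cabs (cexp a) + 1) * cabs (z - a)) <= _).
  by rewrite ler_wpM2l ?cabs_ge0.
rewrite mulrA ler_wpM2r ?cabs_ge0 // mulrA ler_pdivrMr // mulrC ler_pM2l //.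
by rewrite lerDl.
Qed.

Lemma e2pi_entire : entire1 (@e2pi R).
Proof.
apply: (entire1_comp cexp_entire).
by apply: entire1M; [exact: entire1_cst|exact: entire1_id].
Qed.

End ExponentialEntire.



(** * Periodic entire functions of exponential growth *)

Section TrigPolynomial.
Variable R : realType.
Local Notation C := R[i].
Implicit Types (z w a : C).
Local Notation e2pi := (@e2pi R).

(** This is 2 'i sin (3 pi z), whose zeros are the simple zeros at (1/3)Z. *)
Definition sin3 z : C := e2pi (3 / 2 * z) - e2pi (- (3 / 2 * z)).

Lemma sin3E z : sin3 z = e2pi (- (3 / 2 * z)) * (e2pi (3 * z) - 1).
Proof. by rewrite mulrBr mulr1 -e2piD; congr (e2pi _ - _); field. Qed.

Lemma e2piN1 z : e2pi z = 1 -> e2pi (- z) = 1.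
Proof. by move=> h; rewrite e2piN h invr1. Qed.

Lemma sin3_eq0 z : sin3 z = 0 -> exists m : int, z = m%:~R / 3.
Proof.
rewrite sin3E => /eqP; rewrite mulf_eq0 (negPf (e2pi_neq0 _)) /= subr_eq0.
by move=> /eqP/e2pi_eq1[m hm]; exists m; rewrite -hm [3 * z]mulrC mulfK ?pnatr_eq0.
Qed.

Lemma sin3_entire : entire1 sin3.
Proof.
by apply: entire1B; apply: (entire1_comp (@e2pi_entire R)); do ?apply: entire1N;
  apply: entire1M; [exact: entire1_cst|exact: entire1_id|exact: entire1_cst|exact: entire1_id].
Qed.

(** From e2pi (3 z) - 1 = cexp (6 pi 'i (z - a)) - 1 at a zero a, and the
    derivative 1 of cexp at 0. *)
Lemma sin3_simple_zero a : sin3 a = 0 -> exists psi : C -> C,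
  [/\ cont_at psi a, psi a != 0 & forall z, sin3 z = psi z * (z - a)].
Proof.
rewrite sin3E => /eqP; rewrite mulf_eq0 (negPf (e2pi_neq0 _)) /= subr_eq0 => /eqP ha.
have [phi [cphi phi0 hphi]] := cderiv_slope (@cexp_cderiv0 R).
pose k : C := (0 +i* (2 * pi)) * 3.
have k0 : k != 0.
  rewrite mulf_neq0 ?pnatr_eq0 // eq_complex /= negb_and; apply/orP; right.
  by rewrite gt_eqF // mulr_gt0 // pi_gt0.
exists (fun z => e2pi (- (3 / 2 * z)) * (phi (k * (z - a)) * k)); split.
- apply: cont_atM.
    apply: differentiable_cont_at; apply: (entire1_comp (@e2pi_entire R)).
    by apply: entire1N; apply: entire1M; [exact: entire1_cst|exact: entire1_id].
  apply: cont_atM; last first.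
    by apply: differentiable_cont_at; exact: entire1_cst.
  apply: (@cont_at_comp _ phi (fun z => k * (z - a))); first by rewrite subrr mulr0.
  apply: differentiable_cont_at; apply: entire1M; first exact: entire1_cst.
  by apply: entire1B; [exact: entire1_id|exact: entire1_cst].
- by rewrite subrr mulr0 phi0 mul1r mulf_neq0 // e2pi_neq0.
move=> z; rewrite sin3E -!mulrA; congr (_ * _).
have -> : 3 * z = 3 * a + 3 * (z - a) by ring.
rewrite e2piD ha mul1r /Defs.e2pi mulrA -/k hphi cexp0 subr0; ring.
Qed.

Lemma Im_realM (r : R) z : complex.Im (r%:C * z) = r * complex.Im z.
Proof. by case: z => x y /=; rewrite mul0r addr0. Qed.

Lemma Im_three_halves z : complex.Im (3 / 2 * z) = 3 / 2 * complex.Im z.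
Proof.
by rewrite -Im_realM; congr (complex.Im (_ * _)); rewrite rmorphM /= fmorphV !rmorph_nat.
Qed.

(** On the vertical lines half way between zeros, e2pi (3 z) is a negative real,
    so the two exponentials in sin3 add up in modulus. *)
Lemma sin3_lower_vertical z (m : nat) :
  `|complex.Re z| = 1 / 6 + m%:R / 3 ->
  expR (3 * pi * `|complex.Im z|) <= cabs (sin3 z).
Proof.
move=> hx; have [n hn] : exists n : int, complex.Re z = 1 / 6 + n%:~R / 3.
  case: (ger0P (complex.Re z)) hx => _ hx; first by exists m%:Z.
  by exists (- (m%:Z) - 1); rewrite intrB mulrNz -pmulrn; lra.
rewrite sin3E.
have -> : e2pi (3 * z) = - (expR (- (6 * pi * complex.Im z)))%:C.
  case: z hn {hx} => x y /= ->.
  have -> : (3 * ((1 / 6 + n%:~R / 3 : R) +i* y) : C) = (1 / 2 : R) +i* (3 * y) + n%:~R.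
    rewrite (_ : n%:~R = (n%:~R : R)%:C); last by rewrite rmorph_int.
    rewrite (_ : (3 : C) = (3 : R)%:C); last by rewrite rmorph_nat.
    by apply/eqP; rewrite eq_complex /=; apply/andP; split; apply/eqP; field.
  rewrite e2piD e2pi_int mulr1 e2piE (_ : 2 * pi * (1 / 2) = pi); last by field.
  rewrite cospi sinpi mulr0 mulrN1 (_ : 2 * pi * (3 * y) = 6 * pi * y); last by ring.
  by apply/eqP; rewrite eq_complex /= oppr0 !eqxx.
rewrite cabsM cabs_e2pi -opprD cabsN -(rmorph1 (real_complex R)) -rmorphD cabs_real.
rewrite [`|expR _ + _|]ger0_norm ?addr_ge0 ?expR_ge0 ?ler01 //.
have -> : complex.Im (- (3 / 2 * z)) = - (3 / 2 * complex.Im z).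
  by rewrite -Im_three_halves; case: (_ * z).
have -> : - (2 * pi * - (3 / 2 * complex.Im z)) = 3 * pi * complex.Im z by field.
rewrite [expR _ * (_ + 1)]mulrDr mulr1 -expRD.
have -> : 3 * pi * complex.Im z + - (6 * pi * complex.Im z) = - (3 * pi * complex.Im z) by ring.
case: (ger0P (complex.Im z)) => _; first by rewrite lerDr expR_ge0.
by rewrite mulrN lerDl expR_ge0.
Qed.

Lemma sin3_lower_horizontal z : 1 <= `|complex.Im z| ->
  expR (3 * pi * `|complex.Im z|) / 2 <= cabs (sin3 z).
Proof.
move=> hy; set Y := `|complex.Im z| in hy *.
have ImE := Im_three_halves z.
have h1 : cabs (e2pi (3 / 2 * z)) = expR (- (3 * pi * complex.Im z)).
  by rewrite cabs_e2pi ImE; congr (expR _); field.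
have h2 : cabs (e2pi (- (3 / 2 * z))) = expR (3 * pi * complex.Im z).
  by rewrite e2piN cabsV h1 -expRN opprK.
have big : expR (- (3 * pi * Y)) <= expR (3 * pi * Y) / 2.
  have h : 2 <= expR (3 * pi * Y).
    apply: le_trans (expR_ge1Dx _); have := pi_ge2 R; nra.
  have h' : 1 <= expR (3 * pi * Y) by lra.
  rewrite expRN; have : (expR (3 * pi * Y))^-1 <= 1 by rewrite invf_le1 // expR_gt0.
  lra.
have := cabs_le_add (e2pi (3 / 2 * z)) (e2pi (- (3 / 2 * z))).
have := cabs_le_add (e2pi (- (3 / 2 * z))) (e2pi (3 / 2 * z)).
rewrite [cabs (_ (- _) - _)]cabsC -/(sin3 z) h1 h2.
move: big; rewrite /Y; case: (ger0P (complex.Im z)) => _; rewrite ?mulrN ?opprK; lra.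
Qed.

(** The coefficient of frequency a of the trigonometric polynomial with
    frequencies -1, 0, 1 that interpolates g at 0, 1/3 and 2/3. *)
Definition dft3 (g : C -> C) (a : int) : C :=
  (\sum_(m < 3) g (m%:R / 3) * e2pi (- (a%:~R * (m%:R / 3)))) / 3.

Lemma periodic_int (g : C -> C) : (forall z, g (z + 1) = g z) ->
  forall z (m : int), g (z + m%:~R) = g z.
Proof.
move=> pg; have pn z (n : nat) : g (z + n%:R) = g z.
  elim: n => [|n IH]; first by rewrite addr0.
  by rewrite -natr1 addrA pg.
move=> z [n|n]; first exact: pn.
by rewrite NegzE mulrNz -pmulrn -[in RHS](subrK n.+1%:R z) pn.
Qed.

Lemma cube_root_sum (w := e2pi (1 / 3)) : w ^+ 3 = 1 /\ w ^+ 2 = - 1 - w.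
Proof.
have w3 : w ^+ 3 = 1 by rewrite /w -e2piX [3 * _]mulrC mulfVK ?pnatr_eq0 // e2pi1.
split=> //; have w1 : w - 1 != 0.
  by rewrite subr_eq0; apply/eqP => /(@e2pi_div_eq1 R 1 3 isT).
apply: (mulfI w1); apply/eqP; rewrite -subr_eq0.
have -> : (w - 1) * w ^+ 2 - (w - 1) * (- 1 - w) = w ^+ 3 - 1 by ring.
by rewrite w3 subrr.
Qed.

(** Discrete Fourier inversion, by 1 + w + w ^ 2 = 0 for the cube root of unity
    w = e2pi (1 / 3). *)
Lemma dft3_interp (g : C -> C) (j : nat) : (j < 3)%N ->
  g (j%:R / 3) = dft3 g 1 * e2pi (j%:R / 3) + dft3 g 0 + dft3 g (- 1) * e2pi (- (j%:R / 3)).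
Proof.
have [] := cube_root_sum; set w := e2pi (1 / 3) => w3 w2.
have iw : w^-1 = w ^+ 2.
  apply: (mulfI (e2pi_neq0 (1 / 3))); rewrite -/w divff ?e2pi_neq0 // -exprS w3.
have ej (n : nat) : e2pi (n%:R / 3) = w ^+ n by rewrite /w -e2piX mul1r.
rewrite /dft3 !big_ord_recr !big_ord0 /= !mul0r !mulr0 !oppr0 e2pi0 !mulr1 !mul1r.
rewrite !mulrN1z ?mulN1r ?opprK.
have e1 : e2pi 3^-1 = w by rewrite /w mul1r.
have e2 := ej 2%N.
rewrite !e2piN e1 e2 iw.
have iw2 : (w ^+ 2)^-1 = w by rewrite -iw invrK.
rewrite iw2.
have s0 : 1 + w + w ^+ 2 = 0 by rewrite w2; ring.
(* Both sides of each identity differ by a multiple of 1 + w + w ^ 2. *)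
have t0 (x y z : C) : x = y + z * (1 + w + w ^+ 2) -> y = x.
  by rewrite s0 mulr0 addr0.
case: j => [|[|[|//]]] _.
- rewrite mul0r e2pi0 invr1.
  by apply: (t0 _ _ ((g 3^-1 + g (2 / 3)) / 3)); field.
- rewrite mul1r e1 iw.
  apply: (t0 _ _ ((g 0 + 2 * g 3^-1 * (w - 1) + g (2 / 3) * (w ^+ 2 - w + 1)) / 3)).
  by field.
- rewrite e2 iw2.
  apply: (t0 _ _ ((g 0 + 2 * g (2 / 3) * (w - 1) + g 3^-1 * (w ^+ 2 - w + 1)) / 3)).
  by field.
Qed.

Lemma cabs_e2pi_le z : cabs (e2pi z) <= expR (2 * pi * `|complex.Im z|).
Proof.
rewrite cabs_e2pi ler_expR -mulrN ler_pM2l ?mulr_gt0 ?pi_gt0 //.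
by rewrite -normrN ler_norm.
Qed.

(** Let h be the difference of g and its interpolant, so h vanishes on (1/3)Z
    and is O(e ^ (2 pi |y|)). The quotient u = h ^ 4 / sin3 ^ 3 is entire, with
    u a = 0 at the zeros of sin3 because the numerator wins one order. It is
    bounded, in fact O(e ^ (8 pi |y| - 9 pi |y|)), on boxes whose vertical sides
    avoid the zeros, so it is constant by Liouville and equal to u 0 = 0. The
    exponents 4 and 3 work because 4 * 2 < 3 * 3; the simple quotient
    h / sin3 would need a removable singularity theorem. *)
Theorem periodic_trig_poly (g : C -> C) (A : R) : entire1 g ->
  (forall z, g (z + 1) = g z) ->
  (forall z, cabs (g z) <= A * expR (2 * pi * `|complex.Im z|)) ->
  forall z, g z = dft3 g 1 * e2pi z + dft3 g 0 + dft3 g (- 1) * e2pi (- z).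
Proof.
move=> dg pg hA.
set al := dft3 g 1; set be := dft3 g 0; set ga := dft3 g (- 1).
pose h z := g z - (al * e2pi z + be + ga * e2pi (- z)).
suff h0 z : h z = 0 by move=> z; apply/eqP; rewrite -subr_eq0; apply/eqP; exact: h0.
have dh : entire1 h.
  have d1 : entire1 (fun z => al * e2pi z).
    exact: (entire1M (entire1_cst al) (@e2pi_entire R)).
  have d2 : entire1 (fun z => ga * e2pi (- z)).
    apply: (entire1M (entire1_cst ga)).
    exact: (entire1_comp (@e2pi_entire R) (entire1N (@entire1_id R))).
  exact: (entire1B dg (entire1D (entire1D d1 (entire1_cst be)) d2)).
have ph w : h (w + 1) = h w.
  by rewrite /h pg [- (w + 1)]opprD !e2piD (e2piN1 (e2pi1 R)) e2pi1 !mulr1.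
have hz0 (w : C) : sin3 w = 0 -> h w = 0.
  move=> /sin3_eq0[m ->].
  have mE := divz_eq m 3.
  have r0 : (0 <= (m %% 3)%Z)%R by exact: modz_ge0.
  have r3 : ((m %% 3)%Z < 3)%R by exact: ltz_pmod.
  have [j j3 jE] : exists2 j : nat, (j < 3)%N & (m %% 3)%Z = j%:Z.
    by case: (m %% 3)%Z r0 r3 => // n _ n3; exists n.
  have -> : (m%:~R / 3 : C) = j%:R / 3 + (m %/ 3)%Z%:~R.
    by rewrite {1}mE jE intrD intrM -pmulrn; field.
  by rewrite (periodic_int ph) /h -dft3_interp // subrr.
pose u w := h w ^+ 4 / sin3 w ^+ 3.
have du : entire1 u.
  move=> a; have [s0|sN0] := eqVneq (sin3 a) 0; last first.
    apply: differentiable_mul1; first exact: entire1X.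
    apply: differentiable_inv1; last by rewrite expf_neq0.
    by apply: entire1X; exact: sin3_entire.
  have [psi [cpsi psi0 hpsi]] := sin3_simple_zero s0.
  have /caratheodory[phi cphi hphi] := dh a.
  have {}hphi w : h w = phi w * (w - a) by rewrite hphi hz0 // add0r.
  apply/caratheodory; exists (fun w => (phi w * phi w * (phi w * phi w)) *
     ((psi w)^-1 * (psi w)^-1 * (psi w)^-1)).
    have c1 := cont_atM cphi cphi; have c2 := cont_atV cpsi psi0.
    exact: (cont_atM (cont_atM c1 c1) (cont_atM (cont_atM c2 c2) c2)).
  move=> w; rewrite /u s0 expr0n invr0 mulr0 add0r hphi hpsi.
  have [->|wa] := eqVneq w a; first by rewrite subrr !mulr0 expr0n mul0r.
  have wa0 : w - a != 0 by rewrite subr_eq0.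
  rewrite !exprMn invfM -!exprVn.
  have -> : (w - a) ^+ 4 = (w - a) ^+ 3 * (w - a) by rewrite exprSr.
  rewrite [_ * ((w - a) ^+ 3 * _)]mulrA -!mulrA.
  have X : (w - a) ^+ 3 * (w - a)^-1 ^+ 3 = 1 by rewrite -exprMn divff ?expr1n.
  transitivity (phi w ^+ 4 * (psi w)^-1 ^+ 3 * (w - a) * ((w - a) ^+ 3 * (w - a)^-1 ^+ 3)).
    by ring.
  by rewrite X; ring.
pose B := A + (cabs al + cabs be + cabs ga).
have hB w : cabs (h w) <= B * expR (2 * pi * `|complex.Im w|).
  apply: le_trans (cabsB _ _) _; rewrite /B mulrDl; apply: lerD; first exact: hA.
  apply: le_trans (cabsD _ _) _; rewrite mulrDl; apply: lerD.
    apply: le_trans (cabsD _ _) _; rewrite mulrDl; apply: lerD.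
      by rewrite cabsM ler_wpM2l ?cabs_ge0 ?cabs_e2pi_le.
    rewrite ler_peMr ?cabs_ge0 // -expR0 ler_expR mulr_ge0 ?normr_ge0 //.
    by rewrite mulr_ge0 ?pi_ge0.
  rewrite cabsM ler_wpM2l ?cabs_ge0 //; apply: le_trans (cabs_e2pi_le _) _.
  by case: w => x y /=; rewrite normrN.
have B0 : 0 <= B.
  have := le_trans (cabs_ge0 _) (hB 0); rewrite /= normr0 mulr0 expR0 mulr1.
  by [].
have uz w : u w = u 0.
  apply: (@liouville _ u 0 (8 * B ^+ 4)) => // L0.
  have [m hm] : exists m : nat, Num.max L0 1 <= 1 / 6 + m%:R / 3.
    exists (Num.bound (3 * Num.max L0 1)).
    have : 3 * Num.max L0 1 < (Num.bound (3 * Num.max L0 1))%:R.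
      by apply: archi_boundP; rewrite mulr_ge0 // le_max ler01 orbT.
    by move=> ?; lra.
  move: hm; rewrite ge_max => /andP[hm1 hm2].
  exists (1 / 6 + m%:R / 3) => // v hv.
  have low : expR (3 * pi * `|complex.Im v|) / 2 <= cabs (sin3 v).
    move: hv; rewrite /on_box subr0 => -[[hx _]|[hy _]].
      apply: le_trans (sin3_lower_vertical hx).
      by rewrite ler_pdivrMr // ler_peMr ?expR_ge0 // ler1n.
    by apply: sin3_lower_horizontal; rewrite hy.
  set E := expR (pi * `|complex.Im v|).
  have E1 : 1 <= E by rewrite -expR0 ler_expR mulr_ge0 ?normr_ge0 ?pi_ge0.
  have hv2 := hB v.
  move: low hv2; rewrite -!mulrA !expRM_natl -/E => low hv2.
  have sp : 0 < cabs (sin3 v) by apply: lt_le_trans low; rewrite divr_gt0 ?exprn_gt0 //; lra.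
  rewrite /u cabsM cabsV !cabsX ler_pdivrMr ?exprn_gt0 //.
  have E0 : 0 <= E by lra.
  apply: (@le_trans _ _ ((B * E ^+ 2) ^+ 4)).
    by apply: lerXn2r; rewrite ?nnegrE ?cabs_ge0 ?mulr_ge0 ?exprn_ge0.
  apply: (@le_trans _ _ (8 * B ^+ 4 * (E ^+ 3 / 2) ^+ 3)).
    rewrite (_ : 8 * B ^+ 4 * (E ^+ 3 / 2) ^+ 3 = B ^+ 4 * E ^+ 8 * E); last by field.
    rewrite (_ : (B * E ^+ 2) ^+ 4 = B ^+ 4 * E ^+ 8); last by ring.
    by rewrite ler_peMr // mulr_ge0 // exprn_ge0.
  rewrite ler_wpM2l ?mulr_ge0 ?exprn_ge0 //.
  by apply: lerXn2r; rewrite ?nnegrE ?cabs_ge0 ?divr_ge0 ?exprn_ge0.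
have u0 w : u w = 0.
  by rewrite uz /u /sin3 mulr0 oppr0 subrr expr0n invr0 mulr0.
have [/hz0 //|sN0] := eqVneq (sin3 z) 0.
have /eqP := u0 z; rewrite mulf_eq0 invr_eq0 !expf_eq0 /= (negPf sN0) orbF.
by move=> /eqP.
Qed.

End TrigPolynomial.



(** * The discrete Laplacian as a sum over unit steps *)

Section Neighbours.
Variables (R : realType) (d : nat).
Local Notation C := R[i].
Implicit Types (u : 'rV[int]_d -> C) (n : 'rV[int]_d).

(** The neighbours of 0 in the lattice, indexed by an axis and a sign. *)
Definition step (p : 'I_d * bool) : 'rV[int]_d :=
  if p.2 then delta_mx 0 p.1 else - delta_mx 0 p.1.

Lemma stepE (p : 'I_d * bool) (i : 'I_d) :
  step p 0 i = if i == p.1 then (if p.2 then 1 else -1) else 0.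
Proof. by rewrite /step; case: p.2; rewrite !mxE eqxx /=; case: eqP. Qed.

Lemma norm1_step p : norm1 (step p) = 1.
Proof.
rewrite /norm1 (bigD1 p.1) //= big1 => [|i ip].
  by rewrite stepE eqxx addr0; case: p.2.
by rewrite stepE (negPf ip).
Qed.

Lemma step_inj : injective step.
Proof.
move=> [i b] [j c] /rowP h; have := h i; rewrite !stepE /= eqxx.
by case: eqP => [->|_]; case: b {h}; case: c.
Qed.

Lemma norm1_eq1 (m : 'rV[int]_d) : norm1 m = 1 -> exists p, m = step p.
Proof.
move=> hm; have [j mj] : exists j, m 0 j != 0.
  apply: contrapT => h; move: hm; rewrite /norm1 big1 // => i _.
  by apply/eqP; rewrite normr_eq0; apply/negPn/negP => mi; apply: h; exists i.
have mj1 : 1 <= `|m 0 j| by rewrite -gtz0_ge1 normr_gt0.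
move: hm; rewrite /norm1 (bigD1 j) //= => hm.
have s0 : 0 <= \sum_(i < d | i != j) `|m 0 i| by apply: sumr_ge0.
have s00 : \sum_(i < d | i != j) `|m 0 i| = 0 by lra.
have mj1' : `|m 0 j| = 1 by lra.
have m0 i : i != j -> m 0 i = 0.
  move=> ij; apply/eqP; rewrite -normr_eq0; apply/eqP.
  by apply: (psumr_eq0P (P := fun i => i != j) (F := fun i => `|m 0 i|)).
exists (j, m 0 j == 1); apply/rowP => i; rewrite stepE /=.
have [->|/m0//] := eqVneq i j.
by move: mj1'; case: (ger0P (m 0 j)) => h h1; case: eqP => //; lra.
Qed.

Lemma laplacianE u n : laplacian u n = \sum_(p : 'I_d * bool) u (n + step p).
Proof.
rewrite /laplacian (@reindex_fsbig _ _ _ _ _ (fun p => n + step p) setT); last first.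
  split=> [p _ /=|p p' _ _ /addrI /step_inj //|m /= hm].
    by rewrite addrAC subrr add0r norm1_step.
  have [p hp] := norm1_eq1 hm; exists p => //.
  by rewrite -hp addrC subrK.
rewrite [RHS]fsbig_seq ?index_enum_uniq //.
rewrite [X in _ = \big[_/_]_(a \in X) _](_ : _ = setT) //.
by apply/seteqP; split=> p //= _; rewrite mem_index_enum.
Qed.

End Neighbours.

(** * Eigenvectors in the Floquet space *)

Section Eigenvectors.
Variables (R : realType) (d : nat) (q : 'I_d -> nat).
Hypothesis q_gt0 : forall j, (0 < q j)%N.
Local Notation C := R[i].
Local Notation e2pi := (@e2pi R).
Implicit Types (V u v : 'rV[int]_d -> C) (k : 'rV[C]_d) (lam : C).

(** A null vector of the matrix gives the values on W of a Floquet function u;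
    both sides of the eigenvalue equation are Floquet functions, so agreement on
    W implies agreement everywhere. *)
Lemma bloch_eigenvector V k lam : lattice_periodic q V -> bloch_variety q V (k, lam) ->
  exists u, [/\ floquet_space q k u, (forall n, schrodinger V u n = lam * u n)
    & exists n, u n != 0].
Proof.
move=> Vper; rewrite /bloch_variety /= -det_tr => /eqP/det0P[w w0 hw].
pose u n := \sum_(m : cell q) w 0 (enum_rank m) * floquet_basis k m n.
have uF : floquet_space q k u.
  move=> n j; rewrite /u mulr_sumr; apply: eq_bigr => m _.
  by rewrite (floquet_basis_floquet q_gt0) mulrCA.
have us m : u (site m) = w 0 (enum_rank m).
  rewrite /u (bigD1 m) //= (floquet_basis_site) eqxx mulr1 big1 ?addr0 // => m' mm'.
  by rewrite floquet_basis_site (negPf mm') mulr0.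
exists u; split=> //; last first.
  have /rV0Pn[b wb] := w0; exists (site (enum_val b)).
  by rewrite us enum_valK.
have sF := schrodinger_floquet Vper uF.
have lF : floquet_space q k (fun n => lam * u n).
  by move=> n j; rewrite uF mulrCA.
move=> n; rewrite (floquet_expand q_gt0 sF) (floquet_expand q_gt0 lF n).
apply: eq_bigr => m _; congr (_ * _).
rewrite -(enum_rankK m) (floquet_matrixP q_gt0 V uF) !us enum_valK.
set a := enum_rank m; set D := floquet_matrix q V k.
transitivity (\sum_b w 0 b * (D a b - lam *+ (a == b)) + \sum_b (lam *+ (a == b)) * w 0 b).
  by rewrite -big_split; apply: eq_bigr => b _ /=; rewrite us enum_valK; ring.
have -> : \sum_b w 0 b * (D a b - lam *+ (a == b)) = 0.
  move/rowP: hw => /(_ a); rewrite mxE [RHS]mxE => hwa; rewrite -[RHS]hwa.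
  by apply: eq_bigr => b _; rewrite !mxE.
rewrite add0r (bigD1 a) //= eqxx mulr1n big1 ?addr0 // => b ab.
by rewrite eq_sym (negPf ab) mulr0n mul0r.
Qed.

(** Lattice-periodic functions are the Floquet functions of quasimomentum 0,
    which makes the lemmas on Floquet functions available for them. *)
Lemma periodic_residue u n : floquet_space q 0 u -> exists m : cell q, u n = u (site m).
Proof.
move=> uF.
have lt j : (absz (n 0%R j %% (q j)%:Z)%Z < q j)%N.
  by rewrite -ltz_nat gez0_abs ?modz_ge0 ?ltz_mod // eqz_nat -lt0n.
pose m0 : cell q := [ffun j => Ordinal (lt j)].
exists m0.
have -> : n = site m0 + \row_j ((\row_i (n 0%R i %/ (q i)%:Z)%Z) 0 j * (q j)%:Z).
  apply/rowP => j; rewrite !mxE ffunE /= gez0_abs ?modz_ge0 ?eqz_nat -?lt0n //.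
  by rewrite addrC -divz_eq.
rewrite (floquet_shift _ _ uF) big1 ?e2pi0 ?mul1r // => j _.
by rewrite [(0 : 'rV__) _ _]mxE mulr0.
Qed.

Lemma periodic_max v n1 : floquet_space q 0 v -> v n1 != 0 ->
  exists n0, 0 < cabs (v n0) /\ forall n, cabs (v n) <= cabs (v n0).
Proof.
move=> vF v1; have [m1 hm1] := periodic_residue n1 vF.
have [m _ hm] := @arg_maxP _ R _ m1 predT (fun m : cell q => cabs (v (site m))) isT.
exists (site m); have hn n : cabs (v n) <= cabs (v (site m)).
  by have [m' ->] := periodic_residue n vF; exact: hm.
by split=> //; apply: lt_le_trans (hn n1); rewrite cabs_gt0.
Qed.

Lemma periodic_bounded V : lattice_periodic q V -> exists2 B : R, 0 <= B & forall n, cabs (V n) <= B.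
Proof.
move=> Vper; have VF : floquet_space q 0 V.
  move=> n j; rewrite Vper ?mxE ?e2pi0 ?mul1r // => i.
  rewrite mulmxnE mxE eqxx /=.
  by case: eqP => [->|_] /=; rewrite ?mulr0n ?mul0rn ?dvdz0 // mulr1n natz dvdzz.
exists (\sum_(m : cell q) cabs (V (site m))); first by apply: sumr_ge0 => m _; exact: cabs_ge0.
move=> n; have [m ->] := periodic_residue n VF.
by rewrite (bigD1 m) //= lerDl sumr_ge0 // => i _; exact: cabs_ge0.
Qed.

(** After the gauge transformation below, hopping along the step p carries
    this factor: x_j for a positive step along j, and 1 / x_j for a negative one,
    where x_j is e2pi (k_j / q_j). *)
Definition hop k (p : 'I_d * bool) : C :=
  e2pi (if p.2 then k 0 p.1 / (q p.1)%:R else - (k 0 p.1 / (q p.1)%:R)).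

Lemma hop_neq0 k p : hop k p != 0.
Proof. exact: e2pi_neq0. Qed.

(** Multiplication by e2pi (- gauge k n) turns a Floquet function of
    quasimomentum k into a lattice-periodic one. *)
Definition gauge k (n : 'rV[int]_d) : C := \sum_j (n 0 j)%:~R * (k 0 j / (q j)%:R).

Lemma gaugeD k n m : gauge k (n + m) = gauge k n + gauge k m.
Proof. by rewrite -big_split; apply: eq_bigr => j _; rewrite mxE intrD mulrDl. Qed.

Lemma hopE k p : hop k p = e2pi (gauge k (step p)).
Proof.
rewrite /hop /gauge (bigD1 p.1) //= big1 ?addr0 => [|i ip]; last first.
  by rewrite stepE (negPf ip) mul0r.
by rewrite stepE eqxx; case: p.2; rewrite ?mul1r ?mulrN1z ?mulN1r.
Qed.

Lemma gauged_eigenvector V k lam : lattice_periodic q V -> bloch_variety q V (k, lam) ->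
  exists v, exists n0, [/\ floquet_space q 0 v, 0 < cabs (v n0),
    (forall n, cabs (v n) <= cabs (v n0)) &
    forall n, lam * v n = \sum_p hop k p * v (n + step p) + V n * v n].
Proof.
move=> Vper /(bloch_eigenvector Vper)[u [uF hu [n1 un1]]].
pose v n := u n * e2pi (- gauge k n).
have vF : floquet_space q 0 v.
  move=> n j; rewrite mxE e2pi0 mul1r /v uF gaugeD opprD e2piD.
  have -> : gauge k (delta_mx 0 j *+ q j) = k 0 j.
    have qj : ((q j)%:R : C) != 0 by rewrite pnatr_eq0 -lt0n.
    rewrite /gauge (bigD1 j) //= big1 ?addr0 => [|i ij]; last first.
      by rewrite mulmxnE mxE eqxx /= (negPf ij) mul0rn mul0r.
    by rewrite mulmxnE mxE !eqxx rmorphMn /= mulrC divfK.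
  have -> : u n * e2pi (- gauge k n) =
    (e2pi (k 0 j) * e2pi (- k 0 j)) * (u n * e2pi (- gauge k n)).
    by rewrite -e2piD subrr e2pi0 mul1r.
  ring.
have [|n0 [v0 vmax]] := @periodic_max v n1 vF; first by rewrite mulf_neq0 ?e2pi_neq0.
exists v, n0; split=> // n; rewrite /v mulrA -hu /schrodinger laplacianE mulrDl mulrA.
congr (_ + _); rewrite mulr_suml; apply: eq_bigr => p _.
rewrite hopE gaugeD opprD e2piD.
have -> : u (n + step p) * e2pi (- gauge k n) = (e2pi (gauge k (step p)) * e2pi (- gauge k (step p)))
   * (u (n + step p) * e2pi (- gauge k n)).
  by rewrite -e2piD subrr e2pi0 mul1r.
ring.
Qed.

(** Evaluate the eigenvalue equation at a point where the eigenvector has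
    maximal modulus. *)
Lemma bloch_bound V : lattice_periodic q V -> exists2 B : R, 0 <= B &
  forall k lam, bloch_variety q V (k, lam) -> cabs lam <= B + \sum_p cabs (hop k p).
Proof.
move=> Vper; have [B B0 hB] := periodic_bounded Vper; exists B => // k lam.
move=> /(gauged_eigenvector Vper)[v [n0 [vF v0 vmax /(_ n0) hv]]].
rewrite -(ler_pM2r v0) -cabsM hv; apply: le_trans (cabsD _ _) _.
rewrite addrC mulrDl; apply: lerD.
  by rewrite cabsM ler_wpM2r ?cabs_ge0.
apply: le_trans (cabs_sum _ _ _) _; rewrite mulr_suml; apply: ler_sum => p _.
by rewrite cabsM ler_wpM2l ?cabs_ge0.
Qed.

(** Let w = lam / hop k p. If the other terms of the eigenvalue equation are
    at most e times the amplitude along p, then w v n is within e max |v| of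
    v (n + step p). Iterating q_p times returns to the starting point by
    periodicity, so w ^ q_p is close to 1. *)
Lemma bloch_root_of_unity V : lattice_periodic q V -> exists2 B : R, 0 <= B &
  forall k lam p (e : R), bloch_variety q V (k, lam) -> e <= 1 ->
    B + \sum_(p' | p' != p) cabs (hop k p') <= e * cabs (hop k p) ->
    cabs ((lam / hop k p) ^+ q p.1 - 1) <= 2 ^+ q p.1 * e.
Proof.
move=> Vper; have [B B0 hB] := periodic_bounded Vper; exists B => // k lam p e.
move=> /(gauged_eigenvector Vper)[v [n0 [vF v0 vmax hv]]] e1 he.
have hp0 : 0 < cabs (hop k p) by rewrite cabs_gt0 hop_neq0.
have e0 : 0 <= e.
  rewrite -(pmulr_lge0 _ hp0); apply: le_trans he; rewrite addr_ge0 //.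
  by apply: sumr_ge0 => i _; exact: cabs_ge0.
set w := lam / hop k p; set M := cabs (v n0) in v0 vmax *.
have step1 n : cabs (w * v n - v (n + step p)) <= e * M.
  rewrite -(ler_pM2l hp0) -cabsM.
  have -> : hop k p * (w * v n - v (n + step p)) =
      \sum_(p' | p' != p) hop k p' * v (n + step p') + V n * v n.
    rewrite mulrBr mulrA /w mulrCA divff ?hop_neq0 // mulr1 hv (bigD1 p) //=; ring.
  apply: le_trans (cabsD _ _) _.
  rewrite mulrA [cabs (hop k p) * e]mulrC.
  apply: le_trans (_ : (B + \sum_(p' | p' != p) cabs (hop k p')) * M <= _); last first.
    by rewrite ler_wpM2r // ltW.
  rewrite addrC mulrDl; apply: lerD.
    by rewrite cabsM ler_pM ?cabs_ge0.
  apply: le_trans (cabs_sum _ _ _) _; rewrite mulr_suml; apply: ler_sum => p' _.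
  by rewrite cabsM ler_wpM2l ?cabs_ge0.
(* This crude bound controls the growth of the error along the iteration. *)
have w2 : cabs w <= 2.
  rewrite -(ler_pM2r v0) -cabsM.
  have := cabs_le_add (w * v n0) (v (n0 + step p)).
  have := step1 n0; have := vmax (n0 + step p); nra.
have stepm m : cabs (w ^+ m * v n0 - v (n0 + step p *+ m)) <= (2 ^+ m - 1) * (e * M).
  elim: m => [|m IH]; first by rewrite !expr0 mul1r mulr0n addr0 !subrr cabs0 mul0r.
  have -> : w ^+ m.+1 * v n0 - v (n0 + step p *+ m.+1) =
     w * (w ^+ m * v n0 - v (n0 + step p *+ m)) +
     (w * v (n0 + step p *+ m) - v (n0 + step p *+ m + step p)).
    by rewrite mulrSr addrA exprS; ring.
  apply: le_trans (cabsD _ _) _; rewrite cabsM.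
  have := step1 (n0 + step p *+ m).
  have : cabs w * cabs (w ^+ m * v n0 - v (n0 + step p *+ m)) <= 2 * ((2 ^+ m - 1) * (e * M)).
    by rewrite ler_pM ?cabs_ge0.
  rewrite exprS; lra.
have vq n : v (n + step p *+ q p.1) = v n.
  have vq1 n' : v (n' + delta_mx 0 p.1 *+ q p.1) = v n' by rewrite vF mxE e2pi0 mul1r.
  rewrite /step; case: p.2; first exact: vq1.
  by rewrite -[in RHS](subrK (delta_mx 0 p.1 *+ q p.1) n) vq1 mulNrn.
have := stepm (q p.1); rewrite vq -[X in _ - X]mul1r -mulrBl cabsM -/M mulrA ler_pM2r // => h.
by apply: le_trans h _; rewrite ler_wpM2r // lerBlDr lerDl.
Qed.

End Eigenvectors.



(** * Entire functions of several variables *)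

Section SeveralVariables.
Variables (R : realType) (d : nat).
Local Notation C := R[i].
Local Notation W := ('rV[(C : numFieldType)]_d : normedModType C).
Implicit Types (f g : 'rV[C]_d -> C) (k m : 'rV[C]_d).

Lemma entire_cst (c : C) : entire (fun _ : 'rV[C]_d => c).
Proof. by move=> k; exact: differentiable_cst. Qed.

Lemma entireD f g : entire f -> entire g -> entire (fun k => f k + g k).
Proof. by move=> hf hg k; exact: (differentiableD (hf k) (hg k)). Qed.

Lemma entireB f g : entire f -> entire g -> entire (fun k => f k - g k).
Proof. by move=> hf hg k; exact: (differentiableB (hf k) (hg k)). Qed.

Lemma entireM f g : entire f -> entire g -> entire (fun k => f k * g k).
Proof. by move=> hf hg k; exact: (@differentiableM C _ f g k (hf k) (hg k)). Qed.

Lemma entire_sum (I : Type) (r : seq I) (P : pred I) (F : I -> 'rV[C]_d -> C) :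
  (forall i, entire (F i)) -> entire (fun k => \sum_(i <- r | P i) F i k).
Proof.
move=> hF; elim: r => [|i r IH].
  by under eq_fun do rewrite big_nil; exact: entire_cst.
under eq_fun do rewrite big_cons; case: (P i); last exact: IH.
exact: (entireD (hF i) IH).
Qed.

Lemma entire_prod (I : Type) (r : seq I) (P : pred I) (F : I -> 'rV[C]_d -> C) :
  (forall i, entire (F i)) -> entire (fun k => \prod_(i <- r | P i) F i k).
Proof.
move=> hF; elim: r => [|i r IH].
  by under eq_fun do rewrite big_nil; exact: entire_cst.
under eq_fun do rewrite big_cons; case: (P i); last exact: IH.
exact: (entireM (hF i) IH).
Qed.

Lemma entire_coord (j : 'I_d) : entire (fun k : 'rV[C]_d => k 0 j).
Proof. by move=> k; exact: differentiable_coord. Qed.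

Lemma entire_comp1 (g : C -> C) f : entire1 g -> entire f -> entire (fun k => g (f k)).
Proof. by move=> hg hf k; exact: (@differentiable_comp C _ C^o C^o f g k (hf k) (hg (f k))). Qed.

Lemma entire_comp f (phi : 'rV[C]_d -> 'rV[C]_d) : entire f ->
  (forall k : W, differentiable (phi : W -> W) k) -> entire (fun k => f (phi k)).
Proof.
by move=> hf hphi k; exact: (@differentiable_comp C _ _ C^o phi f k (hphi k) (hf (phi k))).
Qed.

Lemma differentiable_shift m k : differentiable ((fun k => k + m) : W -> W) (k : W).
Proof. by apply: differentiableD; [exact: ex_diff|exact: differentiable_cst]. Qed.

Lemma entire_shift f m : entire f -> entire (fun k => f (k + m)).
Proof. by move=> hf; apply: entire_comp => // k; exact: differentiable_shift. Qed.

Lemma differentiable_reset (j : 'I_d) (c : C) k :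
  differentiable ((fun k => k + (c - k 0 j) *: delta_mx 0 j) : W -> W) (k : W).
Proof.
apply: differentiableD; first exact: ex_diff.
apply: (@differentiableZl C _ _ (fun k : 'rV[C]_d => (c - k 0 j : C^o)) (delta_mx 0 j : 'rV[C]_d) k).
apply: differentiableB; first exact: differentiable_cst.
exact: differentiable_coord.
Qed.

Lemma entire_det n (F : 'I_n -> 'I_n -> 'rV[C]_d -> C) :
  (forall i j, entire (F i j)) -> entire (fun k => \det (\matrix_(i, j) F i j k)).
Proof.
move=> hF; apply: entire_sum => s; apply: entireM; first exact: entire_cst.
apply: entire_prod => i; under eq_fun do rewrite mxE; exact: hF.
Qed.

Lemma entire_line f k m : entire f -> entire1 (fun t => f (k + t *: m)).
Proof.
move=> hf t.
apply: (@differentiable_comp C C^o _ C^o (fun t : C^o => k + t *: m) f t); last exact: hf.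
apply: differentiableD; first exact: differentiable_cst.
by apply: (@differentiableZl C C^o _ (fun t : C^o => t)); exact: ex_diff.
Qed.

(** Join a point a with f a != 0 to an arbitrary point b by a complex line.
    By continuity f is nonzero on the line near a, so g vanishes there, hence on
    the whole line by the one-variable identity theorem. *)
Lemma entire_mul_eq0 f g : entire f -> entire g ->
  (forall k, f k * g k = 0) -> (forall k, f k = 0) \/ (forall k, g k = 0).
Proof.
move=> df dg fg0; have [|/existsNP[a /eqP fa]] := pselect (forall k, f k = 0); first by left.
right=> b; pose G t := g (a + t *: (b - a)).
have dG : entire1 G := entire_line a (b - a) dg.
suff G0 t : G t = 0 by rewrite -(G0 1) /G scale1r addrC subrK.
have dF := entire_line a (b - a) df.
have /cont_atP hc := differentiable_cont_at (dF 0).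
have fa0 : 0 < cabs (f a) by rewrite cabs_gt0.
have [|r r0 hr] := hc (cabs (f a) / 2); first by rewrite divr_gt0.
apply: (entire1_identity dG r0) => z hz; apply/eqP.
have := hr z; rewrite subr0 => /(_ hz); rewrite scale0r addr0 => hfz.
have /eqP := fg0 (a + z *: (b - a)); rewrite mulf_eq0 => /orP[/eqP fz0|//].
by move: hfz; rewrite fz0 sub0r cabsN; lra.
Qed.

Lemma entire_prod_eq0 (I : eqType) (r : seq I) (F : I -> 'rV[C]_d -> C) :
  (forall i, entire (F i)) -> (forall k, \prod_(i <- r) F i k = 0) ->
  exists2 i, i \in r & forall k, F i k = 0.
Proof.
move=> hF; elim: r => [|i r IH] h.
  by have /eqP := h 0; rewrite big_nil oner_eq0.
have hp k : F i k * \prod_(j <- r) F j k = 0 by rewrite -(h k) big_cons.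
have [hi|hr] := entire_mul_eq0 (hF i) (entire_prod r predT hF) hp.
  by exists i; rewrite ?mem_head.
by have [j jr hj] := IH hr; exists j; rewrite // inE jr orbT.
Qed.

Lemma entire_bounded_const f (M : R) : entire f -> (forall k, cabs (f k) <= M) ->
  forall k k', f k = f k'.
Proof.
move=> df hM k k'; have := @liouville _ (fun t => f (k' + t *: (k - k'))) 0 M.
move=> /(_ (entire_line _ _ df)) h; have := h _ 1.
rewrite scale1r scale0r addr0 [k' + _]addrC subrK; apply.
by move=> L0; exists L0.
Qed.

End SeveralVariables.



(** * Determinants with known distinct roots *)

Section Determinant.
Variable R : realType.
Local Notation C := R[i].

Lemma horner_char_poly N (D : 'M[C]_N) (lam : C) :
  (char_poly D).[lam] = \det (lam%:M - D).
Proof.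
rewrite /char_poly -horner_evalE -det_map_mx; congr (\det _).
apply/matrixP => i j; rewrite !mxE /= horner_evalE hornerD hornerN hornerC.
by rewrite hornerMn hornerX.
Qed.

Lemma det_sub_scalar_prod (I : finType) N (D : 'M[C]_N) (r : I -> C) (lam : C) :
  #|I| = N -> injective r -> (forall i, \det (D - (r i)%:M) = 0) ->
  \det (D - lam%:M) = \prod_i (r i - lam).
Proof.
move=> cI inj_r hr.
have sgn mu : \det (D - mu%:M) = (-1) ^+ N * (char_poly D).[mu].
  by rewrite horner_char_poly -opprB -scaleN1r detZ.
have all_r : all (root (char_poly D)) [seq r i | i <- enum I].
  apply/allP => _ /mapP[i _ ->]; rewrite /root; have /eqP := hr i.
  by rewrite sgn mulf_eq0 signr_eq0.
have := all_roots_prod_XsubC _ all_r _.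
rewrite size_char_poly size_map -cardE cI uniq_rootsE map_inj_uniq // enum_uniq.
move=> /(_ erefl isT) h; rewrite sgn h (monicP (char_poly_monic D)) scale1r.
rewrite horner_prod big_map big_enum /= (eq_bigr (fun i => -1 * (r i - lam))) => [|i _].
  by rewrite big_split prodr_const /= cI mulrA -exprMn mulrNN mul1r expr1n mul1r.
by rewrite hornerXsubC mulN1r opprB.
Qed.

End Determinant.

(** * The region where one amplitude dominates *)

Section HopEstimates.
Variables (R : realType) (d : nat) (q : 'I_d -> nat).
Hypothesis q_gt0 : forall j, (0 < q j)%N.
Local Notation C := R[i].
Local Notation e2pi := (@e2pi R).
Implicit Types (k : 'rV[C]_d) (p : 'I_d * bool).

Lemma Im_div_nat (z : C) n : complex.Im (z / n%:R) = complex.Im z / n%:R.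
Proof.
rewrite (_ : n%:R^-1 = ((n%:R : R)^-1)%:C :> C); last by rewrite fmorphV rmorph_nat.
by case: z => x y; rewrite /= mulr0 add0r.
Qed.

Lemma cabs_hop k p : cabs (hop q k p) =
  expR ((if p.2 then - complex.Im (k 0 p.1) else complex.Im (k 0 p.1)) / (q p.1)%:R * (2 * pi)).
Proof.
rewrite /hop; case: p.2; rewrite cabs_e2pi; congr expR.
  by rewrite Im_div_nat; ring.
have -> : complex.Im (- (k 0 p.1 / (q p.1)%:R)) = - (complex.Im (k 0 p.1) / (q p.1)%:R).
  by rewrite -Im_div_nat; case: (_ / _).
ring.
Qed.

(** The modulus of an amplitude depends only on the imaginary part of k, so
    real translations do not affect this domination. *)
Lemma hop_dominates k p (T : R) : 0 <= T ->
  complex.Im (k 0 p.1) = (if p.2 then - T else T) * (q p.1)%:R ->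
  (forall i, i != p.1 -> complex.Im (k 0 i) = 0) ->
  cabs (hop q k p) = expR (2 * pi * T) /\
  forall p', p' != p -> cabs (hop q k p') <= 1.
Proof.
have qR j : ((q j)%:R : R) != 0 by rewrite pnatr_eq0 -lt0n.
move=> T0 hp hi; split.
  by rewrite cabs_hop hp; congr expR; case: p.2; rewrite -?mulNr ?opprK mulfK // mulrC.
case: p hp hi => j b hj hi [i c] hne; rewrite cabs_hop -[X in _ <= X]expR0 ler_expR /=.
rewrite /= in hj hi.
have [ij|ij] := eqVneq i j; last first.
  by rewrite (hi _ ij); case: c {hne}; rewrite ?oppr0 !mul0r.
rewrite ij hj in hne *.
have tp : 0 <= T * (2 * pi) by rewrite mulr_ge0 // mulr_ge0 ?pi_ge0.
by case: b c hne {hj} => -[] //=; rewrite ?eqxx //= => _; rewrite -?mulNr ?opprK mulfK // mulNr oppr_le0.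
Qed.

End HopEstimates.

(** * Isolation of 1 among the roots of unity *)

Section PowerNearOne.
Variable R : realType.
Local Notation C := R[i].

Lemma entire1_sum (I : Type) (r : seq I) (F : I -> C -> C) :
  (forall i, entire1 (F i)) -> entire1 (fun z => \sum_(i <- r) F i z).
Proof.
move=> hF; elim: r => [|i r IH].
  by under eq_fun do rewrite big_nil; exact: entire1_cst.
by under eq_fun do rewrite big_cons; exact: (entire1D (hF i) IH).
Qed.

(** Write z ^ n - 1 = (z - 1) (1 + z + ... + z ^ (n - 1)); the second factor is
    near n >= 1 when z is near 1. *)
Lemma pow_near_one (n : nat) : (0 < n)%N -> exists2 r : R, 0 < r &
  forall z : C, cabs (z - 1) <= r -> cabs (z - 1) <= 2 * cabs (z ^+ n - 1).
Proof.
move=> n0; pose S (z : C) : C := \sum_(i < n) z ^+ i.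
have dS : entire1 S by apply: entire1_sum => i; exact (@entire1X R (fun z => z) i (@entire1_id R)).
have S1 : S 1 = n%:R.
  by rewrite /S (eq_bigr (fun=> 1)) => [|i _]; rewrite ?expr1n // sumr_const card_ord.
have /cont_atP hc := differentiable_cont_at (dS 1).
have [|r r0 hr] := hc (1 / 2); first by rewrite divr_gt0.
exists (r / 2); first by rewrite divr_gt0.
move=> z hz; rewrite subrX1 cabsM -/(S z) mulrCA ler_peMr ?cabs_ge0 //.
have : cabs (S z - S 1) <= 1 / 2 by apply: hr; apply: le_lt_trans hz _; lra.
have := cabs_le_add (S 1) (S z); rewrite cabsC S1 cabs_nat.
have : (1 : R) <= n%:R by rewrite ler1n.
lra.
Qed.

End PowerNearOne.



Lemma ratio_pow_near_one (R : realType) (z b : R[i]) n (e : R) : 0 < e -> e <= 1 -> b != 0 ->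
  cabs (z ^+ n - 1) <= e / 16 -> cabs (b ^+ n - 1) <= e / 16 ->
  2 * cabs ((z / b) ^+ n - 1) < e.
Proof.
move=> e0 e1 b0 hz hb.
have hb2 : 1 / 2 <= cabs (b ^+ n).
  by have := cabs_le_add 1 (b ^+ n); rewrite cabs1 cabsC; lra.
have -> : (z / b) ^+ n - 1 = ((z ^+ n - 1) - (b ^+ n - 1)) / b ^+ n.
  by rewrite opprB addrA subrK mulrBl divff ?expf_neq0 // expr_div_n.
have := cabsB (z ^+ n - 1) (b ^+ n - 1).
rewrite cabsM cabsV mulrA ltr_pdivrMr; last exact: lt_le_trans hb2.
move: (cabs (b ^+ n)) (cabs (z ^+ n - 1)) (cabs (b ^+ n - 1)) (cabs (_ - _)) hz hb hb2.
by move=> *; nra.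
Qed.

(** * Translates of an entire branch *)

Section EntireBranch.
Variables (R : realType) (d : nat) (q : 'I_d -> nat) (V : 'rV[int]_d -> R[i]).
Hypothesis q_gt0 : forall j, (0 < q j)%N.
Hypothesis Vper : lattice_periodic q V.
Local Notation C := R[i].
Local Notation e2pi := (@e2pi R).
Implicit Types (k : 'rV[C]_d) (p : 'I_d * bool) (m : 'I_d -> int).

Let qC_neq0 j : ((q j)%:R : C) != 0.
Proof. by rewrite pnatr_eq0 -lt0n. Qed.

Lemma floquet_basis_int_shift k m (b : cell q) n :
  floquet_basis (k + \row_j (m j)%:~R) b n = floquet_basis k b n.
Proof.
rewrite /floquet_basis; case: ifP => // _.
rewrite (eq_bigr (fun j => ((n 0%R j %/ (q j)%:Z)%Z)%:~R * k 0 j + ((n 0%R j %/ (q j)%:Z)%Z * m j)%:~R)).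
  by rewrite big_split /= -rmorph_sum /= e2piD e2pi_int mulr1.
by move=> j _; rewrite !mxE mulrDr intrM.
Qed.

Lemma floquet_matrix_int_shift k m :
  floquet_matrix q V (k + \row_j (m j)%:~R) = floquet_matrix q V k.
Proof.
apply/matrixP => a b; rewrite !mxE; congr (schrodinger V _ _).
by apply/funext => n; exact: floquet_basis_int_shift.
Qed.

Lemma entire_floquet_basis (b : cell q) n : entire (fun k => floquet_basis k b n).
Proof.
rewrite /floquet_basis; case: [forall j, _]; last exact: entire_cst.
apply: (entire_comp1 (@e2pi_entire R)).
by apply: entire_sum => j; apply: entireM; [exact: entire_cst|exact: entire_coord].
Qed.

Lemma entire_bloch_det lam : entire (fun k => \det (floquet_matrix q V k - lam%:M)).
Proof.
have -> : (fun k => \det (floquet_matrix q V k - lam%:M)) = (fun k => \det (\matrix_(a < #|cell q|, b < #|cell q|)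
    (\sum_p floquet_basis k (enum_val b) (site (enum_val a) + step p) +
     V (site (enum_val a)) * floquet_basis k (enum_val b) (site (enum_val a)) -
     lam *+ (a == b)))).
  apply/funext => k; congr (\det _); apply/matrixP => a b.
  by rewrite !mxE /schrodinger laplacianE.
apply: entire_det => a b; apply: entireB; last exact: entire_cst.
apply: entireD; first by apply: entire_sum => p; exact: entire_floquet_basis.
by apply: entireM; [exact: entire_cst|exact: entire_floquet_basis].
Qed.

Variable f : 'rV[C]_d -> C.
Hypothesis f_entire : entire f.
Hypothesis f_branch : forall k, bloch_variety q V (k, f k).

Lemma branch_int_shift k m : bloch_variety q V (k, f (k + \row_j (m j)%:~R)).
Proof. by have := f_branch (k + \row_j (m j)%:~R); rewrite /bloch_variety /= floquet_matrix_int_shift. Qed.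

(** At this point the amplitude along p is e ^ (2 pi T), the one against p is
    its inverse, and all the others have modulus 1. *)
Definition ray p (T : R) : 'rV[C]_d :=
  \row_i (if i == p.1 then 0 +i* ((if p.2 then - T else T) * (q p.1)%:R) else 0).

Lemma exists_dominating (A : R) : exists2 T : R, 0 <= T & A <= expR (2 * pi * T).
Proof.
have p0 : 0 < 2 * pi :> R by rewrite mulr_gt0 // pi_gt0.
exists (`|A| / (2 * pi)); first by rewrite divr_ge0 // ltW.
rewrite mulrCA mulfV ?gt_eqF // mulr1.
by have := expR_ge1Dx `|A|; have := ler_norm A; lra.
Qed.

(** Follow w s = f (k_s) / hop (k_s), with k_s = ray + s m for real s in
    [0, 1], so that the amplitude along j dominates for all s. Then w s ^ q_j is
    near 1 throughout, whereas w 1 = eta w 0 with eta = e2pi (- m_j / q_j). If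
    eta is not 1, the intermediate value theorem gives an s with w s / w 0 at a
    fixed small distance from 1, although its q_j-th power is arbitrarily close
    to 1; this contradicts [pow_near_one]. *)
Lemma branch_period_dvd m : (forall k, f (k + \row_j (m j)%:~R) = f k) ->
  forall j, ((q j)%:Z %| m j)%Z.
Proof.
move=> fm j; have [dv|] := pselect (e2pi ((m j)%:~R / (q j)%:R) = 1).
  exact: e2pi_div_eq1 dv.
move=> nd; exfalso.
pose eta := e2pi (- ((m j)%:~R / (q j)%:R)).
have eta1 : eta != 1.
  by apply/eqP => h; apply: nd; rewrite -[_ / _]opprK; exact: e2piN1.
have [r0 r00 hr0] := pow_near_one R (q_gt0 j).
have [dl [dl0 dlr dle]] : exists dl : R, [/\ 0 < dl, dl <= Num.min r0 1 & dl <= cabs (eta - 1)].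
  exists (Num.min (Num.min r0 1) (cabs (eta - 1))).
  split; first by rewrite !lt_min r00 ltr01 cabs_gt0 subr_eq0 eta1.
    by rewrite {1}ge_min lexx.
  by rewrite ge_min lexx orbT.
move: dlr; rewrite le_min => /andP[dlr dl1].
have [B B0 hB] := bloch_root_of_unity q_gt0 Vper.
pose N : R := #|{: 'I_d * bool}|%:R.
have [T T0 hT] := exists_dominating ((B + N) * 2 ^+ q j * 16 / dl).
set X := expR _ in hT; have X0 : 0 < X by exact: expR_gt0.
pose p : 'I_d * bool := (j, true).
pose M : 'rV[C]_d := \row_i (m i)%:~R.
pose kk (s : C) := ray p T + s *: M.
have domk (s : R) : cabs (hop q (kk s%:C) p) = X /\
    forall p', p' != p -> cabs (hop q (kk s%:C) p') <= 1.
  have ImE i : complex.Im (kk s%:C 0 i) = complex.Im (ray p T 0 i).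
    rewrite !mxE; have -> : ((m i)%:~R : C) = ((m i)%:~R : R)%:C by rewrite rmorph_int.
    by case: ifP => _; rewrite /= mul0r mulr0 !addr0.
  apply: hop_dominates => //.
    by rewrite ImE mxE eqxx.
  by move=> i ip; rewrite ImE mxE (negPf ip).
pose w (s : C) := f (kk s) * e2pi (- (kk s 0 j / (q j)%:R)).
have wE s : w s = f (kk s) / hop q (kk s) p by rewrite /w e2piN.
pose e := (B + N) / X.
have eX : 2 ^+ q j * e <= dl / 16.
  rewrite /e mulrA ler_pdivrMr //; move: hT; rewrite ler_pdivrMr // => hT.
  by lra.
have p2 : (1 : R) <= 2 ^+ q j by rewrite exprn_ege1 // ler1n.
have e0 : 0 <= e by rewrite divr_ge0 ?addr_ge0 ?ler0n // ltW.
have e1 : e <= 1.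
  have h : e <= 2 ^+ q j * e by rewrite ler_peMl.
  by lra.
have hw (s : R) : cabs (w s%:C ^+ q j - 1) <= dl / 16.
  have [hX hX'] := domk s; rewrite wE.
  apply: le_trans (hB (kk s%:C) _ p e (f_branch _) e1 _) eX.
  rewrite hX /e divfK ?gt_eqF // lerD2l /N -sum1_card natr_sum.
  rewrite [X in _ <= X](bigD1 p) //=.
  apply: le_trans (_ : \sum_(i | i != p) 1 <= _); last by rewrite lerDr.
  by apply: ler_sum => p' /hX'.
have dw : entire1 w.
  apply: entire1M; first exact: entire_line.
  apply: (entire1_comp (@e2pi_entire R)); apply: entire1N; apply: entire1M; last exact: entire1_cst.
  exact: (entire_line (ray p T) M (@entire_coord R d j)).
set w0 := w 0.
have hw0 := hw 0; rewrite -/w0 in hw0.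
have w0n : w0 != 0.
  apply/eqP => h; move: hw0; rewrite h expr0n (gtn_eqF (q_gt0 j)) sub0r cabsN cabs1; lra.
pose g s := w s / w0 - 1.
have dg : entire1 g.
  by apply: entire1B; [apply: entire1M => //; exact: entire1_cst|exact: entire1_cst].
have g0 : cabs (g 0) = 0 by rewrite /g -/w0 divff // subrr cabs0.
have g1 : g 1 = eta - 1.
  congr (_ - 1); rewrite /w0 /w /kk scale1r scale0r addr0 fm.
  rewrite [in e2pi (- ((_ + M) 0 j / _))]mxE mulrDl opprD e2piD mulrA.
  rewrite [X in X / _]mulrC mulfK; first by rewrite /eta mxE.
  by move: w0n; rewrite /w0 /w /kk scale0r addr0.
pose phi (t : R) := cabs (g t%:C).
have cphi : continuous phi.
  suff -> : phi = (fun t : R => cabs (g (0 + t%:C * 1))).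
    exact: entire1_continuous_segment.
  by apply/funext => t; rewrite add0r mulr1.
have phi0 : phi 0 = 0 by exact: g0.
have phi1 : phi 1 = cabs (eta - 1) by rewrite -g1.
have [s _ hs] : exists2 s, s \in `[0, 1]%R & phi s = dl.
  apply: IVT; [exact: ler01|exact: continuous_subspaceT|].
  by rewrite phi0 phi1 min_l ?cabs_ge0 // max_r ?cabs_ge0 // dle ltW.
have := hr0 (w s%:C / w0); rewrite -/(g s%:C) -/(phi s) hs => /(_ dlr).
apply/negP; rewrite -ltNge.
exact (ratio_pow_near_one dl0 dl1 w0n (hw s) hw0).
Qed.

Definition cell_row (n : cell q) : 'rV[C]_d := \row_j ((n j : nat)%:Z)%:~R.

Lemma branch_shift_inj (m m' : 'I_d -> int) :
  (forall k, f (k + \row_j (m j)%:~R) = f (k + \row_j (m' j)%:~R)) ->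
  forall j, ((q j)%:Z %| m j - m' j)%Z.
Proof.
move=> h; apply: branch_period_dvd => k.
have -> : k + \row_j (m j - m' j)%:~R = (k - \row_j (m' j)%:~R) + \row_j (m j)%:~R.
  by apply/rowP => j; rewrite !mxE intrB; ring.
by rewrite h subrK.
Qed.

Lemma cell_shift_inj (n n' : cell q) :
  (forall k, f (k + cell_row n) = f (k + cell_row n')) -> n = n'.
Proof.
move=> /branch_shift_inj h; apply/ffunP => j; apply/val_inj; apply/eqP.
have := h j; rewrite -eqz_mod_dvd !modz_small ?ltz_nat ?ltn_ord //.
Qed.

(** At a point k where the translates take distinct values, these are Q
    distinct roots of the characteristic polynomial of a Q x Q matrix. So the
    difference of the two sides, times the product of all differences of distinct
    translates, vanishes identically. The second factor is not the zero function
    because no difference of distinct translates is, so the first one is. *)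
Lemma bloch_det_factor k lam :
  \det (floquet_matrix q V k - lam%:M) = \prod_(n : cell q) (f (k + cell_row n) - lam).
Proof.
pose Dl k := \det (floquet_matrix q V k - lam%:M) - \prod_(n : cell q) (f (k + cell_row n) - lam).
pose G k := \prod_(nn : cell q * cell q | nn.1 != nn.2)
   (f (k + cell_row nn.1) - f (k + cell_row nn.2)).
have dD : entire Dl.
  apply: entireB; first exact: entire_bloch_det.
  apply: entire_prod => n; apply: entireB; last exact: entire_cst.
  exact: entire_shift.
have dF (nn : cell q * cell q) : entire (fun k => f (k + cell_row nn.1) - f (k + cell_row nn.2)).
  by apply: entireB; exact: entire_shift.
have dG : entire G by exact: entire_prod.
have DG k' : Dl k' * G k' = 0.
  have [G0|GN0] := eqVneq (G k') 0; first by rewrite G0 mulr0.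
  rewrite /Dl (@det_sub_scalar_prod _ _ _ _ (fun n : cell q => f (k' + cell_row n))) ?subrr ?mul0r //.
    move=> n n' /= fnn'; apply/eqP/negPn/negP => nn'.
    move: GN0; rewrite /G (bigD1 (n, n')) //= fnn' subrr mul0r eqxx //.
  by move=> n; have := branch_int_shift k' (fun j => (n j : nat)%:Z).
have [hD|hG] := entire_mul_eq0 dD dG DG.
  by apply/eqP; rewrite -subr_eq0; apply/eqP; exact: hD.
have [|nn] := @entire_prod_eq0 _ _ _ [seq nn <- index_enum _ | nn.1 != nn.2] _ dF.
  by move=> k'; rewrite big_filter; exact: hG.
rewrite mem_filter => /andP[/eqP nn12 _] h; case: nn12; apply: cell_shift_inj => k'.
by apply/eqP; rewrite -subr_eq0; apply/eqP; exact: h.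
Qed.

(** This translate is a branch, so by the factorisation it coincides with the
    translate by some n in W. Comparing the two shifts modulo the lattice gives
    n = 0. *)
Lemma branch_periodic j k : f (k + (q j)%:R *: delta_mx 0 j) = f k.
Proof.
pose mj (i : 'I_d) : int := if i == j then (q j)%:Z else 0.
have mE : (q j)%:R *: delta_mx 0 j = \row_i (mj i)%:~R :> 'rV[C]_d.
  apply/rowP => i; rewrite !mxE eqxx /= /mj; case: eqP => _ /=; first by rewrite mulr1.
  by rewrite mulr0.
have hp k' : \prod_(n <- index_enum (cell q)) (f (k' + cell_row n) - f (k' + \row_i (mj i)%:~R)) = 0.
  by rewrite -bloch_det_factor; exact: branch_int_shift.
have dF (n : cell q) : entire (fun k' => f (k' + cell_row n) - f (k' + \row_i (mj i)%:~R)).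
  by apply: entireB; exact: entire_shift.
have [n _ hn] := entire_prod_eq0 dF hp.
have hn' k' : f (k' + cell_row n) = f (k' + \row_i (mj i)%:~R).
  by apply/eqP; rewrite -subr_eq0; apply/eqP; exact: hn.
have n0 i : (n i : nat) = 0%N.
  have := branch_shift_inj hn' i.
  have dm : ((q i)%:Z %| mj i)%Z by rewrite /mj; case: eqP => [->|_]; rewrite ?dvdz0.
  rewrite rpredBr // => hd; have := dvdn_leq _ hd; have := ltn_ord (n i).
  by case: (n i : nat) => // x; rewrite ltnNge => /negbTE h /(_ isT); rewrite h.
rewrite mE -hn'; congr f; apply/rowP => i; rewrite !mxE n0 addr0 //.
Qed.

End EntireBranch.



(** * Dependence on a single coordinate *)

Section Reset.
Variables (R : realType) (d : nat).
Local Notation C := R[i].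
Implicit Types k : 'rV[C]_d.

Definition reset (j : 'I_d) (c : C) k : 'rV[C]_d := k + (c - k 0 j) *: delta_mx 0 j.

Lemma resetE j c k i : reset j c k 0 i = if i == j then c else k 0 i.
Proof.
rewrite !mxE eqxx /=; case: eqP => [->|_] /=; first by rewrite mulr1 addrC subrK.
by rewrite mulr0 addr0.
Qed.

Lemma reset_reset j c c' k : reset j c (reset j c' k) = reset j c k.
Proof. by apply/rowP => i; rewrite !resetE; case: eqP. Qed.

Lemma reset_id j k : reset j (k 0 j) k = k.
Proof. by rewrite /reset subrr scale0r addr0. Qed.

Lemma reset_const (T : Type) (F : 'rV[C]_d -> T) :
  (forall j c k, F (reset j c k) = F k) -> forall k, F k = F 0.
Proof.
move=> hF k; pose ks (s : seq 'I_d) : 'rV[C]_d := \row_i (if i \in s then 0 else k 0 i).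
have hs s : F (ks s) = F k.
  elim: s => [|j s IH]; first by congr F; apply/rowP => i; rewrite mxE in_nil.
  rewrite -IH -(hF j 0 (ks s)); congr F; apply/rowP => i.
  by rewrite resetE !mxE in_cons; case: eqP.
rewrite -(hs (enum 'I_d)); congr F; apply/rowP => i.
by rewrite !mxE mem_enum.
Qed.

End Reset.

(** * The form of an entire branch *)

Section Structure.
Variables (R : realType) (d : nat) (q : 'I_d -> nat) (V : 'rV[int]_d -> R[i]).
Hypothesis q_gt0 : forall j, (0 < q j)%N.
Hypothesis Vper : lattice_periodic q V.
Local Notation C := R[i].
Local Notation e2pi := (@e2pi R).
Implicit Types (k : 'rV[C]_d) (p : 'I_d * bool).
Variable f : 'rV[C]_d -> C.
Hypothesis f_entire : entire f.
Hypothesis f_branch : forall k, bloch_variety q V (k, f k).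

Let qC_neq0 j : ((q j)%:R : C) != 0.
Proof. by rewrite pnatr_eq0 -lt0n. Qed.

(** The j-th variable is rescaled so that the period q_j becomes 1. *)
Definition fibre (j : 'I_d) k (z : C) : C := f (reset j ((q j)%:R * z) k).

Definition sgn (b : bool) : int := if b then 1 else -1.

(** The coefficient of hop k p in f; it does not involve the coordinate of k
    along the axis of p. *)
Definition coef p k : C := dft3 (fibre p.1 k) (sgn p.2).

Definition middle j k : C := dft3 (fibre j k) 0.

Lemma fibre_reset j c k : fibre j (reset j c k) = fibre j k.
Proof. by apply/funext => z; rewrite /fibre reset_reset. Qed.

Lemma entire_dft3_fibre j a : entire (fun k => dft3 (fibre j k) a).
Proof.
apply: entireM; last exact: entire_cst.
apply: entire_sum => i; apply: entireM; last exact: entire_cst.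
exact (@entire_comp R d f (reset j ((q j)%:R * ((i : nat)%:R / 3))) f_entire
  (@differentiable_reset R d j _)).
Qed.

Lemma fibre_entire j k : entire1 (fibre j k).
Proof.
have -> : fibre j k = (fun z => f ((k - k 0 j *: delta_mx 0 j) + z *: ((q j)%:R *: delta_mx 0 j))).
  apply/funext => z; congr f; rewrite /reset scalerBl scalerA [z * _]mulrC.
  by rewrite addrCA addrC.
exact: entire_line.
Qed.

Lemma fibre_periodic j k z : fibre j k (z + 1) = fibre j k z.
Proof.
rewrite /fibre -(branch_periodic q_gt0 Vper f_entire f_branch j (reset j ((q j)%:R * z) k)).
congr f; apply/rowP => i; rewrite resetE !mxE eqxx /=.
case: eqP => [->|_] /=; last by rewrite !mulr0 !addr0.
ring.
Qed.

Lemma fibre_bound : exists2 N : R, 0 <= N & forall j k, exists2 A : R, 0 <= A &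
  forall z, cabs (fibre j k z) <= A + N * expR (2 * pi * `|complex.Im z|).
Proof.
have [B B0 hB] := bloch_bound q_gt0 Vper.
exists (#|{: 'I_d * bool}|%:R); first exact: ler0n.
move=> j k; exists (B + \sum_p cabs (hop q k p)).
  by rewrite addr_ge0 // sumr_ge0 // => p _; exact: cabs_ge0.
move=> z; apply: le_trans (hB _ _ (f_branch _)) _.
rewrite -addrA lerD2l -sum1_card natr_sum mulr_suml -big_split /=.
apply: ler_sum => -[i b] _; rewrite mul1r.
have [->|ij] := eqVneq i j; last first.
  by rewrite /hop resetE (negPf ij) lerDl expR_ge0.
rewrite ler_wpDl ?cabs_ge0 // /hop /= resetE eqxx.
rewrite [(q j)%:R * z]mulrC mulfK //; case: b; first exact: cabs_e2pi_le.
by apply: le_trans (cabs_e2pi_le _) _; case: z => x y /=; rewrite normrN.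
Qed.

Lemma fibre_expand j k z :
  fibre j k z = coef (j, true) k * e2pi z + middle j k + coef (j, false) k * e2pi (- z).
Proof.
have [N N0 /(_ j k)[A A0 hA]] := fibre_bound.
apply: (@periodic_trig_poly _ (fibre j k) (A + N)).
- exact: fibre_entire.
- exact: fibre_periodic.
move=> w; apply: le_trans (hA w) _; rewrite [(A + N) * _]mulrDl lerD2r ler_peMr //.
by rewrite -expR0 ler_expR mulr_ge0 ?mulr_ge0 ?pi_ge0.
Qed.

Lemma branch_expand j k : f k =
  coef (j, true) k * hop q k (j, true) + middle j k + coef (j, false) k * hop q k (j, false).
Proof.
rewrite /hop /= -fibre_expand /fibre.
have -> : (q j)%:R * (k 0 j / (q j)%:R) = k 0 j by rewrite mulrC divfK.
by rewrite reset_id.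
Qed.

(** Let the imaginary part of the free variable tend to infinity in the
    direction in which the term of [coef p k] dominates in [fibre_expand]. The
    growth rate N of the fibres does not depend on k, and the modulus of the
    coefficient is at most N + 1. *)
Lemma coef_bounded p : exists M : R, forall k, cabs (coef p k) <= M.
Proof.
case: p => j b; have [N N0 hN] := fibre_bound; exists (N + 1) => k.
have [A A0 hA] := hN j k.
set a := coef (j, b) k; set a' := coef (j, ~~ b) k; set m := middle j k.
rewrite leNgt; apply/negP => lt.
have [T T0 hT] := exists_dominating (A + cabs m + cabs a' + 1).
have m0 := cabs_ge0 m; have a0 := cabs_ge0 a'.
have [X hX0] : exists X, X = expR (2 * pi * T) by exists (expR (2 * pi * T)).
rewrite -hX0 in hT.
have X1 : 1 <= X by lra.
pose z : C := 0 +i* (if b then - T else T).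
have hX : expR (2 * pi * `|complex.Im z|) = X.
  by rewrite hX0 /z /=; case: (b); rewrite ?normrN ger0_norm.
have e1 : cabs (e2pi (if b then z else - z)) = X.
  by rewrite cabs_e2pi hX0 /z; case: (b) => /=; congr expR; ring.
have e2 : cabs (e2pi (if b then - z else z)) <= 1.
  have -> : (if b then - z else z) = - (if b then z else - z).
    by case: (b); rewrite ?opprK.
  by rewrite e2piN cabsV e1 invf_le1 //; lra.
have hz : fibre j k z = a * e2pi (if b then z else - z) + m + a' * e2pi (if b then - z else z).
  rewrite fibre_expand /a /a' /m; clear; move: z => z.
  case: b => //; move: (coef _ _) (coef _ _) (middle _ _) (e2pi _) (e2pi _) => x1 x2 x3 x4 x5.
  by ring.
have hA' := hA z; rewrite hX in hA'.
have h1 : cabs (a * e2pi (if b then z else - z)) <= A + N * X + cabs m + cabs a'.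
  have -> : a * e2pi (if b then z else - z) =
    fibre j k z - m - a' * e2pi (if b then - z else z) by rewrite hz; ring.
  apply: le_trans (cabsB _ _) _; apply: lerD.
    by apply: le_trans (cabsB _ _) _; rewrite lerD2r.
  by rewrite cabsM ler_piMr ?cabs_ge0.
rewrite cabsM e1 in h1.
have h2 : (N + 1) * X <= cabs a * X by rewrite ler_wpM2r //; lra.
lra.
Qed.

Lemma coef_const p k : coef p k = coef p 0.
Proof.
have [M hM] := coef_bounded p.
exact: (entire_bounded_const (entire_dft3_fibre p.1 (sgn p.2)) hM).
Qed.

(** The difference of f and the sum does not depend on the coordinate k_j, for
    each j: by [branch_expand] it is the middle coefficient in that variable
    minus terms along the other axes. *)
Theorem branch_structure : exists (c : 'I_d * bool -> C) (K : C),
  forall k, f k = K + \sum_p c p * hop q k p.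
Proof.
pose c p := coef p 0; pose rem k := f k - \sum_p c p * hop q k p.
suff hrem k : rem k = rem 0.
  by exists c, (rem 0) => k; rewrite -(hrem k) /rem subrK.
apply: reset_const => j z k'.
have remE k0 : rem k0 = middle j k0 - \sum_(p | (p != (j, true)) && (p != (j, false))) c p * hop q k0 p.
  rewrite /rem (bigD1 (j, true)) //= (bigD1 (j, false)) /=; last by rewrite xpair_eqE andbF.
  rewrite (branch_expand j k0).
  rewrite /c !(coef_const _ k0); ring.
rewrite !remE /middle fibre_reset; congr (_ - _); apply: eq_bigr => -[i b] /andP[h1 h2].
congr (_ * _); rewrite /hop /= resetE; case: eqP => // ij.
by move: h1 h2; rewrite ij; case: b; rewrite eqxx.
Qed.

End Structure.



(** * The coefficients are roots of unity *)

Section RootsOfUnity.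
Variable R : realType.
Local Notation C := R[i].
Local Notation e2pi := (@e2pi R).

Lemma e2pi_prim_root n : (0 < n)%N -> n.-primitive_root (e2pi (1 / n%:R)).
Proof.
move=> n0; apply/andP; split=> //; apply/forallP => i; apply/eqP.
rewrite unity_rootE -e2piX mulrA mulr1; apply/eqP/eqP => [h|->]; last first.
  by rewrite divff ?e2pi1 // pnatr_eq0 -lt0n.
have := @e2pi_div_eq1 R i.+1%:Z n n0 h.
by rewrite dvdzE /= => /dvdn_leq -/(_ isT) ni; apply/eqP; rewrite eqn_leq ni andbT.
Qed.

Lemma root_of_unity_e2pi n (z : C) : (0 < n)%N -> z ^+ n = 1 ->
  exists2 a : nat, (a < n)%N & z = e2pi (a%:R / n%:R).
Proof.
move=> n0 /(prim_rootP (e2pi_prim_root n0))[a ->]; exists a => //.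
by rewrite -e2piX mulrA mulr1.
Qed.

Lemma e2pi_modn n x (z : C) : (0 < n)%N ->
  e2pi (((x %% n)%N%:R + z) / n%:R) = e2pi ((x%:R + z) / n%:R).
Proof.
move=> n0; have nn : (n%:R : C) != 0 by rewrite pnatr_eq0 -lt0n.
have -> : (x%:R + z) / n%:R = ((x %% n)%N%:R + z) / n%:R + (x %/ n)%N%:R.
  by rewrite {1}(divn_eq x n) natrD natrM; field.
by rewrite e2piD e2pi_nat mulr1.
Qed.

End RootsOfUnity.

Section Coefficients.
Variables (R : realType) (d : nat) (q : 'I_d -> nat) (V : 'rV[int]_d -> R[i]).
Hypothesis q_gt0 : forall j, (0 < q j)%N.
Hypothesis Vper : lattice_periodic q V.
Local Notation C := R[i].
Local Notation e2pi := (@e2pi R).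
Implicit Types (k : 'rV[C]_d) (p : 'I_d * bool).
Variables (f : 'rV[C]_d -> C) (c : 'I_d * bool -> C) (K : C).
Hypothesis f_branch : forall k, bloch_variety q V (k, f k).
Hypothesis fE : forall k, f k = K + \sum_p c p * hop q k p.

Lemma hop_ray p (T : R) : 0 <= T -> cabs (hop q (ray q p T) p) = expR (2 * pi * T) /\
  forall p', p' != p -> cabs (hop q (ray q p T) p') <= 1.
Proof.
move=> T0; apply: hop_dominates => //; first by rewrite mxE eqxx.
by move=> i ip; rewrite mxE (negPf ip).
Qed.

(** Along [ray p T] the quotient f / hop p tends to c p as T tends to infinity,
    and its q_p-th power tends to 1 by [bloch_root_of_unity]. *)
Lemma coef_root_of_unity p : c p ^+ q p.1 = 1.
Proof.
apply/eqP; rewrite -subr_eq0 -cabs_eq0 eq_le cabs_ge0 andbT leNgt; apply/negP.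
set D := cabs (c p ^+ q p.1 - 1) => D0.
have [B B0 hB] := bloch_root_of_unity q_gt0 Vper.
pose N : R := #|{: 'I_d * bool}|%:R.
pose A := cabs K + \sum_(p' | p' != p) cabs (c p').
have A0 : 0 <= A by rewrite addr_ge0 ?cabs_ge0 // sumr_ge0 // => ? _; exact: cabs_ge0.
have N0 : 0 <= N by exact: ler0n.
have dpow : entire1 (fun z : C => z ^+ q p.1).
  exact (@entire1X R (fun z => z) (q p.1) (@entire1_id R)).
have /cont_atP hc := differentiable_cont_at (dpow (c p)).
have [|r r0 hr] := hc (D / 4); first by rewrite divr_gt0.
have [T T0 hT] := exists_dominating (A / r + (B + N) * 2 ^+ q p.1 * 4 / D + (B + N) + 1).
have [X hX0] : exists X, X = expR (2 * pi * T) by exists (expR (2 * pi * T)).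
rewrite -hX0 in hT.
have [] := hop_ray p T0; rewrite -hX0; set k := ray q p T => hX hX'.
have Ar : 0 <= A / r by rewrite divr_ge0 // ltW.
have BN : 0 <= B + N by lra.
have p20 : (0 : R) < 2 ^+ q p.1 by rewrite exprn_gt0.
have BD : 0 <= (B + N) * 2 ^+ q p.1 * 4 / D.
  by rewrite divr_ge0 ?(ltW D0) // mulr_ge0 // mulr_ge0 // ltW.
have X0 : 0 < X by lra.
have h0 : hop q k p != 0 by exact: hop_neq0.
set w := f k / hop q k p.
have wc : cabs (w - c p) < r.
  have -> : w - c p = (K + \sum_(p' | p' != p) c p' * hop q k p') / hop q k p.
    by rewrite /w fE (bigD1 p) //=; field.
  rewrite cabsM cabsV hX ltr_pdivrMr //; apply: (@le_lt_trans _ _ A).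
    apply: le_trans (cabsD _ _) _; rewrite lerD2l.
    apply: le_trans (cabs_sum _ _ _) _; apply: ler_sum => p' /hX' h1.
    by rewrite cabsM ler_piMr ?cabs_ge0.
  have : A / r < X by lra.
  by rewrite ltr_pdivrMr // mulrC.
pose e := (B + N) / X.
have e1 : e <= 1 by rewrite ler_pdivrMr // mul1r; lra.
have eD : 2 ^+ q p.1 * e <= D / 4.
  rewrite /e mulrA ler_pdivrMr //.
  have : (B + N) * 2 ^+ q p.1 * 4 / D <= X by lra.
  by rewrite ler_pdivrMr //; lra.
have hw : cabs (w ^+ q p.1 - 1) <= D / 4.
  apply: le_trans (hB k _ p e (f_branch _) e1 _) eD.
  rewrite hX /e divfK ?gt_eqF // lerD2l /N -sum1_card natr_sum.
  rewrite [X in _ <= X](bigD1 p) //=.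
  apply: le_trans (_ : \sum_(i | i != p) 1 <= _); last by rewrite lerDr.
  by apply: ler_sum => p' /hX'.
have hrw := hr w wc; have := cabs_le_add (c p ^+ q p.1 - 1) (w ^+ q p.1 - 1).
have -> : c p ^+ q p.1 - 1 - (w ^+ q p.1 - 1) = - (w ^+ q p.1 - c p ^+ q p.1).
  by rewrite opprB addrA subrK opprB.
rewrite cabsN -/D => hD; lra.
Qed.

Lemma coef_exponents : exists (a b : 'I_d -> nat), [/\ forall j, (a j < q j)%N,
  forall j, c (j, true) = e2pi ((a j)%:R / (q j)%:R) &
  forall j, c (j, false) = e2pi (- ((b j)%:R / (q j)%:R))].
Proof.
have ha j : {a : nat | (a < q j)%N /\ c (j, true) = e2pi (a%:R / (q j)%:R)}.
  apply: cid; have [a a1 a2] := root_of_unity_e2pi (q_gt0 j) (coef_root_of_unity (j, true)).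
  by exists a.
have hb j : {b : nat | c (j, false) = e2pi (- (b%:R / (q j)%:R))}.
  apply: cid; have [|b _ hb] := @root_of_unity_e2pi R (q j) (c (j, false))^-1 (q_gt0 j).
    by rewrite exprVn (coef_root_of_unity (j, false)) invr1.
  by exists b; rewrite e2piN -hb invrK.
exists (fun j => sval (ha j)), (fun j => sval (hb j)); split=> j.
- by case: (svalP (ha j)).
- by case: (svalP (ha j)).
- exact: (svalP (hb j)).
Qed.

End Coefficients.

(** * Entire branches and the product formula *)

(** The coefficients e2pi (a_j / q_j) of x_j and e2pi (- b_j / q_j) of 1 / x_j
    become those of the product formula when W is translated by a modulo q, and
    then l = b - a modulo q. *)
Theorem theorem1p1 (R : realType) (d : nat) (q : 'I_d -> nat)
    (V : 'rV[int]_d -> R[i])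
    (d_gt0 : (0 < d)%N) (q_gt0 : forall j, (0 < q j)%N)
    (V_periodic : lattice_periodic q V) :
  (exists (l : cell q) (K : R[i]),
     forall (k : 'rV[R[i]]_d) (lambda : R[i]),
       \det (floquet_matrix q V k - lambda%:M) =
       \prod_(n : cell q)
         (K - lambda +
          \sum_(j < d)
            (e2pi (((n j)%:R + k 0 j) / (q j)%:R) +
             e2pi (- (((n j)%:R + (l j)%:R + k 0 j) / (q j)%:R)))))
  <->
  (exists f : 'rV[R[i]]_d -> R[i],
     entire f /\ forall k : 'rV[R[i]]_d, bloch_variety q V (k, f k)).
Proof.
split=> [[l [K hdet]]|[f [f_entire f_branch]]].
  exists (fun k => K + \sum_(j < d) (e2pi (k 0 j / (q j)%:R) +
     e2pi (- (((l j)%:R + k 0 j) / (q j)%:R)))); split.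
    apply: entireD; first exact: entire_cst.
    apply: entire_sum => j; apply: entireD; apply: (entire_comp1 (@e2pi_entire R)).
      by apply: entireM; [exact: entire_coord|exact: entire_cst].
    apply: (entire_comp1 (entire1N (@entire1_id R))).
    apply: entireM; last exact: entire_cst.
    by apply: entireD; [exact: entire_cst|exact: entire_coord].
  move=> k; rewrite /bloch_variety /= hdet.
  pose n0 : cell q := [ffun j => Ordinal (q_gt0 j)].
  rewrite (bigD1 n0) //= opprD addNKr addrC; apply/eqP; rewrite mulf_eq0; apply/orP; left.
  rewrite subr_eq0; apply/eqP; apply: eq_bigr => j _.
  by rewrite ffunE /= !add0r.
have [c [K fE]] := branch_structure q_gt0 V_periodic f_entire f_branch.
have [a [b [aq ha hb]]] := coef_exponents q_gt0 V_periodic f_branch fE.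
have lP j : ((b j + (q j - a j)) %% q j < q j)%N by rewrite ltn_pmod.
pose l : cell q := [ffun j => Ordinal (lP j)].
have sP (n : cell q) j : ((n j + a j) %% q j < q j)%N by rewrite ltn_pmod.
pose s (n : cell q) : cell q := [ffun j => Ordinal (sP n j)].
have s_inj : injective s.
  move=> n n' /ffunP h; apply/ffunP => j; apply/val_inj => /=.
  have := congr1 val (h j); rewrite !ffunE /= => /eqP; rewrite eqn_modDr => /eqP.
  by rewrite !modn_small.
exists l, K => k lam.
rewrite (bloch_det_factor q_gt0 V_periodic f_entire f_branch) [RHS](reindex_inj s_inj).
apply: eq_bigr => n _; rewrite fE addrAC; congr (_ + _).
rewrite (eq_bigr (fun p => (fun j (t : bool) => c (j, t) * hop q (k + cell_row R n) (j, t)) p.1 p.2)); last by case.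
rewrite -(pair_bigA _ (fun j (t : bool) => c (j, t) * hop q (k + cell_row R n) (j, t))) /=.
apply: eq_bigr => j _; rewrite big_bool /= ha hb /hop /= -!e2piD !mxE !ffunE /=.
congr (_ + _).
  by rewrite e2pi_modn // natrD; congr e2pi; ring.
rewrite -opprD !e2piN; congr (_^-1).
rewrite -[in RHS]addrA e2pi_modn // addrCA e2pi_modn // addrA -natrD -(e2pi_modn _ _ (q_gt0 j)).
have -> : (b j + (q j - a j) + (n j + a j) = q j + (n j + b j))%N.
  by have := aq j; lia.
rewrite modnDl e2pi_modn // natrD; congr e2pi; ring.
Qed.
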